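(* Let $\epsilon>0$ and let $s,k\ge 1$ be integers. If there is a simplifiable SUSP $P$ that is an $(s,k)$-puzzle, then there is an algorithm for multiplying $n\times n$ matrices (over a field $\mathbb{F}$) in time $O(n^{\omega+\epsilon})$, where $$\omega \le \inf_{m\in\mathbb{N},\, m\ge 3} 3\cdot\frac{k\log m-\log s}{k\log(m-1)}.$$
   Context: Matrix multiplication. Given $n\in\mathbb{N}$, a field $\mathbb{F}$ and $A,B\in\mathbb{F}^{n\times n}$, compute $C=AB$. Time is measured by the number of arithmetic operations in $\mathbb{F}$ as a function of $n$. Puzzles. For $s,k\in\mathbb{N}$, an $(s,k)$-puzzle is a subset $P\subseteq\{1,2,3\}^k$ with $|P|=s$. 3D graphs. A 3D graph $H$ with finite domain $U$ is given by an edge set $E(H)\subseteq U^3$ (a 3-uniform hypergraph on three disjoint copies of $U$). Its projections are the 2D graphs $R_0,R_1,R_2$ on $U$ with edge sets $E(R_0)=\{(v,w): \exists u,\ (u,v,w)\in E(H)\}$, $E(R_1)=\{(u,w):\exists v,\ (u,v,w)\in E(H)\}$, $E(R_2)=\{(u,v):\exists w,\ (u,v,w)\in E(H)\}$. The trivial matching on $U$ is $\{(u,u,u):u\in U\}$. Simplification. Let $S\subseteq U$ and $f\in\{0,1,2\}$. $S$ induces a simplification of $R_f$ if $E(R_f)\cap (S\times(U\setminus S))=\emptyset$ or $E(R_f)\cap((U\setminus S)\times S)=\emptyset$. In that case the simplification of $H$ induced by $S$ via $R_f$ is the 3D graph obtained from $H$ by deleting every edge whose projection to $R_f$ (i.e.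 the pair obtained by dropping the first, second, or third coordinate for $f=0,1,2$ respectively) lies in $(S\times(U\setminus S))\cup((U\setminus S)\times S)$. $H$ simplifies to $H'$ if there is a finite (possibly empty) sequence $H=H_0,H_1,\dots,H_\ell=H'$ and pairs $(S_j,f_j)$ such that $H_j$ is the simplification of $H_{j-1}$ induced by $S_j$ via the projection $R_{f_j}$ of $H_{j-1}$, for each $1\le j\le \ell$ (projections are recomputed at each step). The graph $H_P$. For a puzzle $P\subseteq\{1,2,3\}^k$, $H_P$ is the 3D graph with domain $P$ in which $(u,v,w)\in P^3$ is an edge if and only if there is no $i\in\{1,\dots,k\}$ such that exactly two of the conditions $u_i=1$, $v_i=2$, $w_i=3$ hold. Simplifiable SUSP. An $(s,k)$-puzzle $P$ is a simplifiable SUSP (strong uniquely solvable puzzle) if $H_P$ simplifies to the 3D graph whose edge set is the trivial matching $\{(u,u,u):u\in P\}$. *)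

(* Defs.v *)
From HB Require Import structures.
From mathcomp Require Import all_boot all_order all_algebra.

Set Implicit Arguments.
Unset Strict Implicit.
Unset Printing Implicit Defensive.

Section Graph3.
Variable U : finType.

Definition graph3 := {set U * U * U}.

Definition drop_coord (f : 'I_3) (e : U * U * U) : U * U :=
  let: (u, v, w) := e in
  if f == 0%N :> nat then (v, w) else if f == 1%N :> nat then (u, w) else (u, v).

Definition proj (f : 'I_3) (H : graph3) : {set U * U} :=
  [set drop_coord f e | e in H].

Definition trivial_matching : graph3 := [set (u, u, u) | u in U].

Definition induces_simplification (H : graph3) (S : {set U}) (f : 'I_3) : bool :=
  (proj f H :&: setX S (~: S) == set0)
  || (proj f H :&: setX (~: S) S == set0).

Definition simplification (H : graph3) (S : {set U}) (f : 'I_3) : graph3 :=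
  [set e in H | drop_coord f e \notin setX S (~: S) :|: setX (~: S) S].

Definition simplifies_in_one_step : rel graph3 := fun H H' =>
  [exists S : {set U}, [exists f : 'I_3,
     induces_simplification H S f && (H' == simplification H S f)]].

Definition simplifies_to (H H' : graph3) : bool :=
  connect simplifies_in_one_step H H'.

End Graph3.

Definition puzzle (k : nat) := {set {ffun 'I_k -> 'I_3}}.

(* The element j of 'I_3 stands for the symbol j + 1 of {1, 2, 3}. *)
Definition symbol (j : 'I_3) : nat := j.+1.

Definition puzzle_graph (k : nat) (P : puzzle k) : graph3 {u | u \in P} :=
  [set e : {u | u \in P} * {u | u \in P} * {u | u \in P} |
    let: (u, v, w) := e in
    ~~ [exists i : 'I_k,
          (symbol (val u i) == 1) + (symbol (val v i) == 2)
          + (symbol (val w i) == 3) == 2]].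

Definition simplifiable_SUSP (k : nat) (P : puzzle k) : bool :=
  simplifies_to (puzzle_graph P) (trivial_matching {u | u \in P}).

(* An algorithm over F is one loop program that serves all n.  Natural-number
   index variables are used only for addressing and control flow, which are
   free of charge; two-dimensional arrays hold elements of F.  A program cannot
   test elements of F, and each addition, subtraction and multiplication in F
   costs 1.  Loading one of the finitely many constants of F occurring in the
   program, and copying, are free. *)

Inductive index_op := IdxAdd | IdxSub | IdxMul | IdxDiv | IdxMod.

Inductive index_expr :=
  | IdxVar of nat
  | IdxConst of nat
  | IdxBin of index_op & index_expr & index_expr.

Inductive field_op := FieldAdd | FieldSub | FieldMul.

(* Cell a e1 e2 is the entry in row e1 and column e2 of array number a. *)
Inductive cell := Cell of nat & index_expr & index_expr.

Inductive program (F : Type) :=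
  | Skip
  | Seq of program F & program F
  | SetIndex of nat & index_expr
  | LoadConst of cell & F
  | Copy of cell & cell
  | Arith of cell & field_op & cell & cell
  | IfNonzero of index_expr & program F & program F
  | For of nat & index_expr & program F.

Arguments Skip {F}.
Arguments SetIndex {F}.
Arguments Copy {F}.
Arguments Arith {F}.

Section Semantics.
Variable F : fieldType.

Record state := State {
  index_of : nat -> nat;
  memory : nat * nat * nat -> F;
  field_ops : nat }.

Definition eval_index_op (o : index_op) : nat -> nat -> nat :=
  match o with
  | IdxAdd => addn
  | IdxSub => subn
  | IdxMul => muln
  | IdxDiv => divn
  | IdxMod => modn
  end.

Fixpoint eval_index (r : nat -> nat) (e : index_expr) : nat :=
  match e with
  | IdxVar x => r x
  | IdxConst c => c
  | IdxBin o e1 e2 => eval_index_op o (eval_index r e1) (eval_index r e2)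
  end.

Definition eval_field_op (o : field_op) (a b : F) : F :=
  match o with
  | FieldAdd => (a + b)%R
  | FieldSub => (a - b)%R
  | FieldMul => (a * b)%R
  end.

Definition address (st : state) (l : cell) : nat * nat * nat :=
  let: Cell a e1 e2 := l in
  (a, eval_index (index_of st) e1, eval_index (index_of st) e2).

Definition read (st : state) (l : cell) : F := memory st (address st l).

Definition write (l : cell) (v : F) (st : state) : state :=
  State (index_of st) [eta memory st with address st l |-> v] (field_ops st).

Definition set_index (x c : nat) (st : state) : state :=
  State [eta index_of st with x |-> c] (memory st) (field_ops st).

Definition charge_one (st : state) : state :=
  State (index_of st) (memory st) (field_ops st).+1.

(* The bound of a For loop is evaluated once, on entry. *)
Fixpoint exec (p : program F) (st : state) : state :=
  match p with
  | Skip => st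
  | Seq p1 p2 => exec p2 (exec p1 st)
  | SetIndex x e => set_index x (eval_index (index_of st) e) st
  | LoadConst l c => write l c st
  | Copy l l1 => write l (read st l1) st
  | Arith l o l1 l2 =>
      charge_one (write l (eval_field_op o (read st l1) (read st l2)) st)
  | IfNonzero e p1 p2 =>
      if eval_index (index_of st) e != 0 then exec p1 st else exec p2 st
  | For x e p1 =>
      iteri (eval_index (index_of st) e)
            (fun i st' => exec p1 (set_index x i st')) st
  end.

Definition entry (n : nat) (A : 'M[F]_n) (i j : nat) : F :=
  match insub i, insub j with
  | Some i', Some j' => A i' j'
  | _, _ => 0%R
  end.

(* On input (n, A, B), index variable 0 holds n, arrays 0 and 1 hold A and B,
   and everything else is 0; the product is to be left in array 2. *)
Definition initial_state (n : nat) (A B : 'M[F]_n) : state :=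
  State (fun x => if x == 0 then n else 0)
        (fun l => let: (a, i, j) := l in
           if a == 0 then entry A i j else if a == 1 then entry B i j else 0%R)
        0.

Definition multiplies_matrices_in_time (p : program F) (T : nat -> nat) : Prop :=
  forall (n : nat) (A B : 'M[F]_n),
    let final := exec p (initial_state A B) in
    (forall i j : 'I_n, memory final (2, i : nat, j : nat) = (A *m B)%R i j)
    /\ field_ops final <= T n.

End Semantics.

(* Main.v *)
Require Import Defs.
From HB Require Import structures.
From mathcomp Require Import all_boot all_order all_algebra.
From mathcomp Require Import qpoly zify.
Import Order.TTheory GRing.Theory Num.Theory.

(* Put q = m - 1.  On q + 1 = m points take the weights 1, ..., 1, t with t and q + t
   invertible.  The weighted sum of products admits dual families of q vectors orthogonal to
   the constant vector 1, so a puzzle column contributes 0 if exactly two of u_i = 1,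
   v_i = 2, w_i = 3 hold and a Kronecker delta if u_i = v_i = w_i.  This diagonal algebra
   replaces the group algebra of Z/m in the argument of Cohn and Umans and needs no roots of
   unity: if every triple of rows of V other than (u, u, u) has such a bad column, then |V|
   disjoint matrix products have rank at most m^(number of columns).

   Such a V comes from sequences of N rows of P in which every row occurs equally often as
   in every other sequence of V.  If R_f has no edge from S to its complement, comparing the
   numbers of terms in S shows that triples of such sequences use no edge in the opposite
   direction either, so every simplification preserves them and they end up in the trivial
   matching.  By pigeonhole V may have s^N / (N + 1)^s elements.

   Schoenhage's argument turns the disjoint products into one product of b x b matrices of
   rank r with log_b r close to the bound, and the algorithm is its recursion, run breadth
   first: encode both factors level by level, multiply entrywise, decode. *)

Set Implicit Arguments.
Unset Strict Implicit.
Unset Printing Implicit Defensive.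

(** * Sequences with equal occurrence counts *)

Section Occurrences.
Variables U I : finType.
Implicit Types (a b c : {ffun I -> U}) (H : graph3 U).

(** Counts are kept in ['I_#|I|.+1] so that only [#|I|.+1 ^ #|U|] count vectors exist, as the
    pigeonhole argument requires. *)
Definition occurrences a : {ffun U -> 'I_#|I|.+1} :=
  [ffun x => inord #|[set j | a j == x]|].

Lemma occurrencesE a x : occurrences a x = #|[set j | a j == x]| :> nat.
Proof. by rewrite ffunE inordK // ltnS max_card. Qed.

Lemma sum_occurrences a (G : U -> nat) :
  \sum_j G (a j) = \sum_x occurrences a x * G x.
Proof.
rewrite (partition_big a predT) //=; apply: eq_bigr => x _.
rewrite (eq_bigr (fun=> G x)) => [|j /eqP-> //].
by rewrite sum_nat_const occurrencesE cardsE.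
Qed.

Lemma card_occurrences a (S : {set U}) :
  #|[set j | a j \in S]| = \sum_(x in S) occurrences a x.
Proof.
rewrite -sum1_card big_mkcond /=.
under eq_bigr do rewrite inE.
rewrite (sum_occurrences a (fun x => if x \in S then 1 else 0)) [RHS]big_mkcond.
by apply: eq_bigr => x _; case: ifP; rewrite ?muln1 ?muln0.
Qed.

(** The positions where [a] is in [S] are among those where [b] is; equal counts make the two sets
    equally large, hence equal. *)
Lemma occurrences_no_crossing a b (S : {set U}) :
  occurrences a = occurrences b ->
  (forall j, a j \in S -> b j \in S) -> forall j, (a j \in S) = (b j \in S).
Proof.
move=> ab sub j.
have /setP/(_ j) : [set j | a j \in S] = [set j | b j \in S].
  apply/eqP; rewrite eqEcard; apply/andP; split.
    by apply/subsetP => i; rewrite !inE; apply: sub.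
  by rewrite !card_occurrences ab.
by rewrite !inE.
Qed.

Definition in_graph H a b c := forall j, (a j, b j, c j) \in H.

Lemma in_graph_simplification H S f a b c :
  occurrences a = occurrences b -> occurrences b = occurrences c ->
  induces_simplification H S f ->
  in_graph H a b c -> in_graph (simplification H S f) a b c.
Proof.
move=> ab bc ind Habc.
(* [g] and [h] are the two sequences left after dropping coordinate [f]. The missing direction gives
   one implication at every position, and equal counts give the converse. *)
have key (g h : {ffun I -> U}) : occurrences g = occurrences h ->
    (forall j, drop_coord f (a j, b j, c j) = (g j, h j)) ->
    in_graph (simplification H S f) a b c.
  move=> gh fE j; rewrite inE Habc fE !inE /=.
  have Hp i : (g i, h i) \in proj f H by rewrite -fE; apply: imset_f; apply: Habc.
  suff -> : (g j \in S) = (h j \in S) by case: (h j \in S).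
  case/orP: ind => /eqP/setP ind.
    apply: occurrences_no_crossing gh _ _ => i gi.
    by have := ind (g i, h i); rewrite !inE Hp gi /= => /negbFE.
  apply/esym; apply: occurrences_no_crossing (esym gh) _ _ => i hi.
  by have := ind (g i, h i); rewrite !inE Hp hi /= andbT => /negbFE.
case: f ind key => -[|[|[|//]]] f3 ind key.
- exact: (key b c).
- by apply: (key a c) => //; rewrite ab.
- exact: (key a b).
Qed.

Lemma in_graph_simplifies_to H H' a b c :
  occurrences a = occurrences b -> occurrences b = occurrences c ->
  simplifies_to H H' -> in_graph H a b c -> in_graph H' a b c.
Proof.
move=> ab bc /connectP[p]; elim: p H => [|H1 p IH] H /=; first by move=> _ ->.
case/andP=> /existsP[S /existsP[f /andP[ind /eqP H1E]]] Hp HE Habc.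
apply: IH Hp HE _; rewrite H1E; exact: in_graph_simplification.
Qed.

Lemma large_occurrence_class :
  exists o, #|U| ^ #|I| <= #|[set a | occurrences a == o]| * #|I|.+1 ^ #|U|.
Proof.
apply/existsP; apply: contraT; rewrite negb_exists => /forallP small.
have tot : #|U| ^ #|I| = \sum_o #|[set a | occurrences a == o]|.
  rewrite -card_ffun -sum1_card (partition_big occurrences predT) //=.
  by apply: eq_bigr => o _; rewrite sum1_card cardsE.
have cardO : #|{: {ffun U -> 'I_#|I|.+1}}| = #|I|.+1 ^ #|U|.
  by rewrite card_ffun card_ord.
(* The [+ 1] records strictness. Summed over all classes it leaves an excess equal to the number of
   count vectors, which is positive. *)
have : \sum_(o : {ffun U -> 'I_#|I|.+1}) (#|[set a | occurrences a == o]| * #|I|.+1 ^ #|U| + 1)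
       <= \sum_(o : {ffun U -> 'I_#|I|.+1}) #|U| ^ #|I|.
  by apply: leq_sum => o _; rewrite addn1 ltnNge.
rewrite big_split -big_distrl /= -tot !sum_nat_const cardO muln1 mulnC.
by rewrite -[leqRHS]addn0 leq_add2l leqn0 expn_eq0.
Qed.

End Occurrences.

(** * Tensor rank *)

Section TensorRank.
Local Open Scope ring_scope.

(** A tensor is given by its array of coefficients, over arbitrary index types; each summand is a
    product of one function per index. *)
Definition rank_le (A : pzRingType) (X Y Z : Type) (T : X -> Y -> Z -> A) (r : nat) :=
  exists (f : 'I_r -> X -> A) (g : 'I_r -> Y -> A) (h : 'I_r -> Z -> A),
    forall x y z, T x y z = \sum_i f i x * g i y * h i z.

Lemma rank_le_card (A : pzRingType) (X Y Z : Type) (T : X -> Y -> Z -> A)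
    (I : finType) (f : I -> X -> A) (g : I -> Y -> A) (h : I -> Z -> A) :
  (forall x y z, T x y z = \sum_i f i x * g i y * h i z) -> rank_le T #|I|.
Proof.
move=> TE; exists (fun i => f (enum_val i)), (fun i => g (enum_val i)), (fun i => h (enum_val i)).
move=> x y z; rewrite TE (reindex (enum_val (A := I))) //=.
exact/onW_bij/enum_val_bij.
Qed.

Lemma rank_le_comp (A : pzRingType) (X Y Z X' Y' Z' : Type) (T : X -> Y -> Z -> A) (r : nat)
    (f : X' -> X) (g : Y' -> Y) (h : Z' -> Z) :
  rank_le T r -> rank_le (fun x y z => T (f x) (g y) (h z)) r.
Proof.
case=> [a [b [c TE]]].
by exists (fun i => a i \o f), (fun i => b i \o g), (fun i => c i \o h) => x y z; apply: TE.
Qed.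

Lemma rank_le_leq (A : pzRingType) (X Y Z : Type) (T : X -> Y -> Z -> A) (r r' : nat) :
  (r <= r')%N -> rank_le T r -> rank_le T r'.
Proof.
move=> /subnKC <- [a [b [c TE]]].
pose ext W (a : 'I_r -> W -> A) (i : 'I_(r + (r' - r))) (x : W) :=
  if split i is inl j then a j x else 0.
exists (ext _ a), (ext _ b), (ext _ c) => x y z; rewrite TE big_split_ord /=.
rewrite [X in _ = _ + X]big1 ?addr0 => [|i _].
  by apply: eq_bigr => i _; rewrite /ext (unsplitK (inl _ i)).
by rewrite /ext (unsplitK (inr _ i)) !mul0r.
Qed.

(* The support of |V| disjoint copies of the tensor of the I x I by I x I matrix product;
   the third factor is indexed by the transposed product. *)
Definition matmul_support (V I : finType) (x y z : V * I * I) : bool :=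
  let: (u, i, j) := x in let: (v, j', l) := y in let: (w, l', i') := z in
  [&& u == v, v == w, j == j', l == l' & i == i'].

Definition matmul_copies (A : pzRingType) (V I : finType) (x y z : V * I * I) : A :=
  (matmul_support x y z)%:R.

(** Injections preserve the equalities that define the support, so the smaller tensor is a
    restriction of the larger one. *)
Lemma rank_le_matmul_copies (A : pzRingType) (V I V' I' : finType) (r : nat) :
  (#|V'| <= #|V|)%N -> (#|I'| <= #|I|)%N ->
  rank_le (@matmul_copies A V I) r -> rank_le (@matmul_copies A V' I') r.
Proof.
move=> leV leI.
pose emb (T T' : finType) (le : (#|T'| <= #|T|)%N) (x : T') : T :=
  enum_val (widen_ord le (enum_rank x)).
have embI (T T' : finType) (le : (#|T'| <= #|T|)%N) : injective (emb T T' le).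
  by move=> x y /enum_val_inj/(congr1 val)/= /val_inj/enum_rank_inj.
pose lift (x : V' * I' * I') := (emb _ _ leV x.1.1, emb _ _ leI x.1.2, emb _ _ leI x.2).
move=> /(rank_le_comp lift lift lift).
case=> [a [b [c TE]]]; exists a, b, c => x y z; rewrite -TE.
case: x y z => [[u i] j] [[v j'] l] [[w l'] i']; rewrite /matmul_copies /=.
by rewrite !(inj_eq (embI _ _ leV)) !(inj_eq (embI _ _ leI)).
Qed.

Lemma rank_le_matmul1 (A : pzRingType) (V : finType) : rank_le (@matmul_copies A V unit) #|V|.
Proof.
apply: (@rank_le_card A _ _ _ _ V (fun u x => (x.1.1 == u)%:R) (fun u x => (x.1.1 == u)%:R)
  (fun u x => (x.1.1 == u)%:R)) => -[[u []] []] [[v []] []] [[w []] []]; rewrite /matmul_copies /=.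
rewrite (bigD1 u) //= (eqxx u) mul1r big1 ?addr0 => [|x ne]; last first.
  by rewrite (eq_sym u) (negbTE ne) !mul0r.
rewrite -natrM mulnb andbT (eq_sym u).
by case: eqVneq => //= <-; rewrite (eq_sym w).
Qed.

(* Schoenhage: the g * |V| products of the outer algorithm are evaluated |V| at a time by
   the inner one. *)
Lemma rank_le_matmul_step (A : comNzRingType) (V I J : finType) (g r : nat) :
  rank_le (@matmul_copies A V I) (g * #|V|) -> rank_le (@matmul_copies A V J) r ->
  rank_le (@matmul_copies A V (I * J)%type) (g * r).
Proof.
case=> [a [b [c TE]]] [a' [b' [c' TE']]].
(* The outer products are numbered by a batch [p] and a position [v] in the batch. *)
pose idx (p : 'I_g) (v : V) : 'I_(g * #|V|) := mxvec_index p (enum_rank v).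
have sum_idx (F : 'I_(g * #|V|) -> A) : \sum_i F i = \sum_p \sum_v F (idx p v).
  rewrite (reindex _ (curry_mxvec_bij _ _)) /= pair_bigA /=.
  rewrite (reindex (fun pv : 'I_g * V => (pv.1, enum_rank pv.2))) //=.
  exists (fun pv => (pv.1, enum_val pv.2)) => -[p v] _ /=.
    by rewrite enum_rankK.
  by rewrite enum_valK.
(* An operand of product [v] of a batch is a combination of [J] by [J] blocks; it is fed to copy [v]
   of the inner tensor. *)
pose ext (a : 'I_(g * #|V|) -> V * I * I -> A) (a' : 'I_r -> V * J * J -> A)
    (pt : 'I_g * 'I_r) (x : V * (I * J) * (I * J)) :=
  \sum_v a (idx pt.1 v) (x.1.1, x.1.2.1, x.2.1) * a' pt.2 (v, x.1.2.2, x.2.2).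
have := @rank_le_card A _ _ _ (@matmul_copies A V (I * J)%type) _
  (ext a a') (ext b b') (ext c c').
rewrite card_prod !card_ord; apply.
move=> [[u [i1 i2]] [j1 j2]] [[v [j1' j2']] [l1 l2]] [[w [l1' l2']] [i1' i2']].
have -> : matmul_copies A (u, (i1, i2), (j1, j2)) (v, (j1', j2'), (l1, l2)) (w, (l1', l2'), (i1', i2'))
  = matmul_copies A (u, i1, j1) (v, j1', l1) (w, l1', i1') * [&& j2 == j2', l2 == l2' & i2 == i2']%:R.
  rewrite /matmul_copies /= -natrM mulnb !xpair_eqE; congr (_%:R); congr nat_of_bool.
  by case: (u == v); case: (v == w); case: (j1 == j1'); case: (j2 == j2'); case: (l1 == l1');
    case: (l2 == l2'); case: (i1 == i1'); case: (i2 == i2').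
rewrite TE sum_idx mulr_suml.
rewrite -(pair_bigA _ (fun p t => ext a a' (p, t) (u, (i1, i2), (j1, j2))
  * ext b b' (p, t) (v, (j1', j2'), (l1, l2)) * ext c c' (p, t) (w, (l1', l2'), (i1', i2')))) /=.
apply: eq_bigr => p _; rewrite /ext /=.
have sum3 (F G H : V -> A) : (\sum_x F x) * (\sum_y G y) * (\sum_z H z)
    = \sum_x \sum_y \sum_z F x * G y * H z.
  rewrite big_distrlr /= mulr_suml; apply: eq_bigr => x _.
  by rewrite mulr_suml; apply: eq_bigr => y _; rewrite mulr_sumr.
under [RHS]eq_bigr do rewrite sum3.
(* Summing over [t] produces the inner tensor, which vanishes unless [x = y = z], so only the
   diagonal of the triple sum survives. *)
have key x y z : \sum_t a (idx p x) (u, i1, j1) * a' t (x, i2, j2)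
      * (b (idx p y) (v, j1', l1) * b' t (y, j2', l2))
      * (c (idx p z) (w, l1', i1') * c' t (z, l2', i2'))
    = a (idx p x) (u, i1, j1) * b (idx p y) (v, j1', l1) * c (idx p z) (w, l1', i1') *
      matmul_copies A (x, i2, j2) (y, j2', l2) (z, l2', i2').
  by rewrite TE' mulr_sumr; apply: eq_bigr => t _; rewrite (mulrACA (a _ _)) [LHS]mulrACA.
rewrite [RHS]exchange_big mulr_suml /=; apply: eq_bigr => x _.
rewrite exchange_big (bigD1 x) //= [X in _ = _ + X]big1 ?addr0 => [|y ne]; last first.
  rewrite exchange_big big1 // => z _.
  by rewrite key /matmul_copies /= eq_sym (negbTE ne) mulr0.
rewrite exchange_big (bigD1 x) //= [X in _ = _ + X]big1 ?addr0 => [|z ne]; last first.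
  by rewrite key /matmul_copies /= eqxx eq_sym (negbTE ne) mulr0.
by rewrite key /matmul_copies /= eqxx.
Qed.

(** Each level costs a factor [g], the number of batches; the last factor [v] pays for the [v]
    scalar products at the bottom. *)
Lemma rank_le_matmul_pow (A : comNzRingType) (v n g l : nat) :
  rank_le (@matmul_copies A 'I_v 'I_n) (g * v) ->
  rank_le (@matmul_copies A 'I_v 'I_(n ^ l)) (g ^ l * v).
Proof.
move=> rk; elim: l => [|l IH].
  rewrite !expn0 mul1n -[X in rank_le _ X](card_ord v).
  by apply: rank_le_matmul_copies (rank_le_matmul1 A 'I_v); rewrite ?card_ord ?card_unit.
rewrite !expnS -mulnA.
have := rank_le_matmul_step (V := 'I_v) (I := 'I_n) (J := 'I_(n ^ l)).
rewrite card_ord => /(_ _ _ _ rk IH).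
by apply: rank_le_matmul_copies; rewrite ?card_prod !card_ord.
Qed.

(* Fixing the outer indices l, l' of the second and third factors turns the tensor
   into the identity matrix of size n^2, factored through r dimensions. *)
Lemma leq_rank_matmul (F : fieldType) (n r : nat) :
  rank_le (@matmul_copies F 'I_1 'I_n) r -> (n * n <= r)%N.
Proof.
case: n => [//|n] [a [b [c TE]]].
pose M : 'M[F]_(#|{: 'I_n.+1 * 'I_n.+1}|, r) :=
  \matrix_(x, i) a i (ord0, (enum_val x).1, (enum_val x).2).
pose N : 'M[F]_(r, #|{: 'I_n.+1 * 'I_n.+1}|) :=
  \matrix_(i, y) (b i (ord0, (enum_val y).2, ord0) * c i (ord0, ord0, (enum_val y).1)).
suff MN : M *m N = 1%:M by have := mulmx1_min MN; rewrite card_prod card_ord.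
apply/matrixP => x y; rewrite !mxE.
transitivity (@matmul_copies F _ _ (ord0 : 'I_1, (enum_val x).1, (enum_val x).2)
  (ord0, (enum_val y).2, ord0) (ord0, ord0, (enum_val y).1)).
  by rewrite TE; apply: eq_bigr => i _; rewrite !mxE mulrA.
rewrite /matmul_copies /= ?andbT; congr (_%:R); congr nat_of_bool.
rewrite -(inj_eq (@enum_val_inj _ _)).
by case: (enum_val x) (enum_val y) => [i j] [i' j']; rewrite xpair_eqE andbC.
Qed.

(* phi of a product of three elements is a trilinear form in their coordinates. *)
Lemma rank_le_descent (F : comNzRingType) (E : comAlgType F) (d : nat) (e : 'I_d -> E)
    (coord : E -> 'I_d -> F) (phi : E -> F) (X Y Z : Type) (T : X -> Y -> Z -> nat) (r : nat) :
  (forall x, x = \sum_j coord x j *: e j) -> scalar phi -> phi 1 = 1 ->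
  rank_le (fun x y z => (T x y z)%:R : E) r ->
  rank_le (fun x y z => (T x y z)%:R : F) (d ^ 3 * r).
Proof.
move=> coordP phi_lin phi1 [a [b [c TE]]].
pose L := GRing.isLinear.Build F E F *%R phi phi_lin.
pose f : {scalar E} := HB.pack phi L.
have := @rank_le_card F _ _ _ (fun x y z => (T x y z)%:R) ('I_d * 'I_d * 'I_d * 'I_r)%type
  (fun p x => coord (a p.2 x) p.1.1.1) (fun p y => coord (b p.2 y) p.1.1.2)
  (fun p z => coord (c p.2 z) p.1.2 * f (e p.1.1.1 * e p.1.1.2 * e p.1.2)).
rewrite !card_prod !card_ord -!mulnA => P; apply: P => x y z.
(* The values of [T] are natural multiples of 1, and [f] carries these from [E] to [F]. *)
have -> : (T x y z)%:R = f (T x y z)%:R by rewrite raddfMn /= phi1.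
pose G (p : 'I_d * 'I_d * 'I_d) (i : 'I_r) := coord (a i x) p.1.1 * coord (b i y) p.1.2 *
  (coord (c i z) p.2 * f (e p.1.1 * e p.1.2 * e p.2)).
have prodE (u v w : E) : u * v * w = \sum_j \sum_k \sum_l
    (coord u j * coord v k * coord w l) *: (e j * e k * e l).
  rewrite {1}(coordP u) {1}(coordP v) {1}(coordP w) !mulr_suml; apply: eq_bigr => j _.
  rewrite [X in X * _ = _]mulr_sumr mulr_suml; apply: eq_bigr => k _.
  rewrite mulr_sumr; apply: eq_bigr => l _.
  by rewrite -!scalerAl -!scalerAr -!scalerAl !scalerA; congr (_ *: _); apply: mulrAC.
rewrite TE raddf_sum -(pair_bigA _ G) exchange_big; apply: eq_bigr => i _.
rewrite -(pair_bigA _ (fun p q => G (p, q) i)) -(pair_bigA _ (fun p q => \sum_s G (p, q, s) i)).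
rewrite (prodE (a i x)) raddf_sum; apply: eq_bigr => j _.
rewrite raddf_sum; apply: eq_bigr => k _; rewrite raddf_sum; apply: eq_bigr => l _.
by apply: etrans (linearZ _ _) _; rewrite /G /= mulrA.
Qed.

(** Every class has a representative of degree below that of the modulus, so the powers of the class
    of X span the quotient. *)
Lemma qpoly_sum_coef (F : comNzRingType) (h : {poly F}) (a : {poly %/ h}) :
  a = \sum_(j < (size (mk_monic h)).-1) (a : {poly F})`_j *: ('qX ^+ j : {poly %/ h}).
Proof.
have E : in_qpoly h (a : {poly F}) = a.
  by apply: val_inj; apply: in_qpoly_small (size_mk_monic _).
rewrite -[LHS]E; have sz : (size (a : {poly F}) <= (size (mk_monic h)).-1)%N.
  by rewrite -ltnS prednK ?size_mk_monic_gt0 ?size_mk_monic.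
have aE : (a : {poly F}) = \sum_(j < (size (mk_monic h)).-1) (a : {poly F})`_j *: 'X^j.
  rewrite -(poly_def _ (fun j => (a : {poly F})`_j)); apply/polyP => i; rewrite coef_poly.
  by case: ltnP => // le; rewrite nth_default // (leq_trans sz le).
rewrite [X in in_qpoly h X]aE (raddf_sum (in_qpoly h)); apply: eq_bigr => j _.
apply: etrans (in_qpolyZ h _ _) _; congr (_ *: _).
exact: rmorphXn (in_qpoly h) j 'X.
Qed.

End TensorRank.

(** * Tensors of local SUSPs *)

Section LocalSUSPs.
Local Open Scope ring_scope.

Definition bad_column (a b c : 'I_3) : bool :=
  ((symbol a == 1) + (symbol b == 2) + (symbol c == 3) == 2)%N.

Definition on_symbol (S : Type) (a : 'I_3) (s0 s1 s2 : S) : S :=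
  match val a with 0%N => s0 | 1%N => s1 | _ => s2 end.

Section LocalSUSP.
Variables (A : comNzRingType) (q : nat) (t t' s' : A).
Hypotheses (tt' : t * t' = 1) (ss' : (q%:R + t) * s' = 1).

Let weight (p : 'I_q.+1) : A := if p == ord_max then t else 1.
(** [basis i] is a unit vector corrected at the last point to have weighted sum [1 - t * t' = 0];
    [dual i] is a unit vector minus its weighted mean [s']. Subtracting a constant does not affect
    the pairing with [basis], which is therefore a Kronecker delta. *)
Let basis (i : 'I_q) (p : 'I_q.+1) : A :=
  if p == ord_max then - t' else (p == widen_ord (leqnSn q) i)%:R.
Let dual (i : 'I_q) (p : 'I_q.+1) : A := (p == widen_ord (leqnSn q) i)%:R - s'.

Let sum_weight (F : 'I_q.+1 -> A) :
  \sum_p weight p * F p = \sum_(i < q) F (widen_ord (leqnSn q) i) + t * F ord_max.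
Proof.
rewrite big_ord_recr /= /weight eqxx; congr (_ + _); apply: eq_bigr => i _.
by rewrite ifN ?mul1r // -(inj_eq val_inj) /= ltn_eqF.
Qed.

Let widen_max (i : 'I_q) : (widen_ord (leqnSn q) i == ord_max) = false.
Proof. by rewrite -(inj_eq val_inj) /= ltn_eqF. Qed.

Let sum_delta (i : 'I_q) (F : 'I_q -> A) :
  \sum_(j < q) (widen_ord (leqnSn q) j == widen_ord (leqnSn q) i)%:R * F j = F i.
Proof.
rewrite (bigD1 i) //= eqxx mul1r big1 ?addr0 // => j ne.
by rewrite -(inj_eq val_inj) /= (inj_eq val_inj) (negbTE ne) mul0r.
Qed.

Let sum_basis i : \sum_p weight p * basis i p = 0.
Proof.
rewrite sum_weight /basis eqxx mulrN tt'.
under eq_bigr do rewrite widen_max -[_%:R]mulr1.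
by rewrite (sum_delta i (fun=> 1)) subrr.
Qed.

Let sum_dual i : \sum_p weight p * dual i p = 0.
Proof.
rewrite sum_weight /dual big_split /= sumr_const card_ord.
under eq_bigr do rewrite -[_%:R]mulr1.
rewrite (sum_delta i (fun=> 1)) [ord_max == _]eq_sym widen_max sub0r.
by rewrite mulrN mulNrn -addrA -opprD -mulr_natl -mulrDl ss' subrr.
Qed.

Let sum_basis_dual i j : \sum_p weight p * (basis i p * dual j p) = (i == j)%:R.
Proof.
rewrite sum_weight /basis eqxx.
under eq_bigr do rewrite widen_max.
rewrite sum_delta /dual [ord_max == _]eq_sym widen_max sub0r mulrNN mulrA tt' mul1r subrK.
by rewrite -(inj_eq val_inj).
Qed.

(** Symbols 1, 2, 3 make the first, second, third vector constant, respectively. In a bad column two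
    factors are constant and the third has weighted sum 0; in a column of equal symbols the two
    others are a [basis] and a [dual] vector with the same role. *)
Let xvec a i l := on_symbol a (fun=> 1) (basis i) (basis l).
Let yvec a l o := on_symbol a (basis o) (fun=> 1) (dual l).
Let zvec a o i := on_symbol a (dual o) (dual i) (fun=> 1).

Let column_sum_bad a b c i l l' o o' i' : bad_column a b c ->
  \sum_p weight p * xvec a i l p * yvec b l' o p * zvec c o' i' p = 0.
Proof.
rewrite /xvec /yvec /zvec /on_symbol /bad_column /symbol.
case: a b c => -[|[|[|//]]] ? [[|[|[|//]]] ?] [[|[|[|//]]] ?] //= _;
  by under eq_bigr do rewrite ?mulr1; rewrite ?sum_basis ?sum_dual.
Qed.

Let column_sum_good a i l l' o o' i' :
  \sum_p weight p * xvec a i l p * yvec a l' o p * zvec a o' i' p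
  = (on_symbol a (o == o') (i == i') (l == l'))%:R.
Proof.
rewrite /xvec /yvec /zvec /on_symbol.
case: a => -[|[|[|//]]] ? /=;
  by under eq_bigr do rewrite ?mulr1 -mulrA; rewrite sum_basis_dual.
Qed.

(** There is one summand per point of the product of the [q.+1]-point sets over all columns, so the
    total is the product of the column sums. Equal symbol frequencies make the three index sets of
    the matrices coincide. *)
Lemma rank_le_local_SUSP (K : nat) (V J : finType) (row : V -> J -> 'I_3) :
  (forall u v w, (forall j, ~~ bad_column (row u j) (row v j) (row w j)) -> u = v /\ v = w) ->
  (forall u c, #|[set j | row u j == c]| = K.+1) ->
  rank_le (@matmul_copies A V {ffun 'I_K.+1 -> 'I_q}) (q.+1 ^ #|J|).
Proof.
move=> localP cardP.
(* j is the (rk u j)-th column of its symbol in row u, so (row u j, rk u j) indexes the columns. *)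
pose rk u j : 'I_K.+1 := inord (index j (enum [set j' | row u j' == row u j])).
(* Every coordinate of a matrix index is thus tested by some column. *)
have rk_surj u c n : exists2 j, row u j = c & rk u j = n.
  have [j0 _] : exists j0, j0 \in [set j | row u j == c].
    by apply/set0Pn; rewrite -card_gt0 cardP.
  have sz : (n < size (enum [set j | row u j == c]))%N by rewrite -cardE cardP.
  exists (nth j0 (enum [set j | row u j == c]) n).
    by apply/eqP; have := mem_nth j0 sz; rewrite mem_enum inE.
  have /eqP E : row u (nth j0 (enum [set j | row u j == c]) n) == c.
    by have := mem_nth j0 sz; rewrite mem_enum inE.
  by rewrite /rk E index_uniq ?enum_uniq ?inord_val.
have <- : #|{ffun J -> 'I_q.+1}| = (q.+1 ^ #|J|)%N by rewrite card_ffun card_ord.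
have := (@rank_le_card A _ _ _ (@matmul_copies A V {ffun 'I_K.+1 -> 'I_q}) {ffun J -> 'I_q.+1}
  (fun p x => \prod_j (weight (p j) * xvec (row x.1.1 j) (x.1.2 (rk x.1.1 j)) (x.2 (rk x.1.1 j)) (p j)))
  (fun p x => \prod_j yvec (row x.1.1 j) (x.1.2 (rk x.1.1 j)) (x.2 (rk x.1.1 j)) (p j))
  (fun p x => \prod_j zvec (row x.1.1 j) (x.1.2 (rk x.1.1 j)) (x.2 (rk x.1.1 j)) (p j))).
apply=> -[[u i] l] [[v l'] o] [[w o'] i']; rewrite /matmul_copies /=.
under eq_bigr do rewrite -!big_split /=.
rewrite -(bigA_distr_bigA (fun j p => weight p * xvec (row u j) (i (rk u j)) (l (rk u j)) p
  * yvec (row v j) (l' (rk v j)) (o (rk v j)) p * zvec (row w j) (o' (rk w j)) (i' (rk w j)) p)) /=.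
case: (boolP [exists j, bad_column (row u j) (row v j) (row w j)]) => [/existsP[j bad]|good].
  rewrite (bigD1 j) //= column_sum_bad // mul0r.
  (* Three equal symbols satisfy exactly one of the three conditions, so no column is bad when
     [u = v = w]. *)
  case: eqP => //= uv; case: eqP => //= vw; move: bad; rewrite -vw -uv.
  by rewrite /bad_column /symbol; case: (row u j) => -[|[|[|//]]].
have [j|-> ->] := localP u v w; first by move: good; rewrite negb_exists => /forallP.
rewrite !eqxx /=; under eq_bigr do rewrite column_sum_good.
case: (boolP [&& l == l', o == o' & i == i']) => [/and3P[/eqP-> /eqP-> /eqP->]|ne].
  by rewrite big1 // => j _; rewrite !eqxx /on_symbol; case: (val _) => [|[]].
(* Where two matrix indices differ, a column with the matching symbol has sum 0. *)
have [j bad] : exists j, ~~ on_symbol (row w j) (o (rk w j) == o' (rk w j))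
    (i (rk w j) == i' (rk w j)) (l (rk w j) == l' (rk w j)).
  have diff (c : 'I_3) (f g : {ffun 'I_K.+1 -> 'I_q}) :
      f != g -> exists2 j, row w j = c & f (rk w j) != g (rk w j).
    move=> fg; have [n fgn] : exists n, f n != g n.
      by apply/existsP; rewrite -negb_forall; apply: contra fg => /eqfunP fg; apply/eqP/ffunP.
    by have [j jc jn] := rk_surj w c n; exists j => //; rewrite jn.
  move: ne; rewrite !negb_and => /or3P[] /diff.
  - by case/(_ (Ordinal (isT : 2 < 3)%N)) => j jc ne; exists j; rewrite jc.
  - by case/(_ (Ordinal (isT : 0 < 3)%N)) => j jc ne; exists j; rewrite jc.
  - by case/(_ (Ordinal (isT : 1 < 3)%N)) => j jc ne; exists j; rewrite jc.
by rewrite (bigD1 j) //= (negbTE bad) mul0r.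
Qed.

End LocalSUSP.

(* The units t and q + t exist in F itself unless F has characteristic 2 and q = 1 in F;
   then x and x + 1 are units of F[x]/(x^2 + x + 1). *)
Lemma rank_le_local_SUSP_field (F : fieldType) (q K : nat) (V J : finType) (row : V -> J -> 'I_3) :
  (forall u v w, (forall j, ~~ bad_column (row u j) (row v j) (row w j)) -> u = v /\ v = w) ->
  (forall u c, #|[set j | row u j == c]| = K.+1) ->
  rank_le (@matmul_copies F V {ffun 'I_K.+1 -> 'I_q}) (8 * q.+1 ^ #|J|).
Proof.
move=> localP cardP.
have inF (t : F) : t != 0 -> q%:R + t != 0 ->
    rank_le (@matmul_copies F V {ffun 'I_K.+1 -> 'I_q}) (8 * q.+1 ^ #|J|).
  move=> t0 qt0; have := rank_le_local_SUSP (divff t0) (divff qt0) localP cardP.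
  by apply: rank_le_leq; rewrite leq_pmull.
(* The candidates are [t = 1] and then [t = -1]. If both fail, [q] equals both -1 and 1 in [F], so
   that 2 = 0. *)
have [q1|] := eqVneq (q%:R + 1 : F) 0; last exact: (inF 1 (oner_neq0 _)).
have [two0|] := eqVneq (q%:R - 1 : F) 0; last by apply: inF; rewrite oppr_eq0 oner_neq0.
have qE : q%:R = 1 :> F by apply/eqP; rewrite -subr_eq0 two0.
have char2 : 1 + 1 = 0 :> F by rewrite -{1}qE.
pose h : {poly F} := 'X^2 + 'X + 1.
have size_h : size h = 3%N.
  by rewrite /h -addrA size_polyDl size_polyXn // -[1]/1%:P size_XaddC.
have monic_h : h \is monic.
  by rewrite monicE /h -addrA lead_coefDl ?lead_coefXn // size_polyXn -[1]/1%:P size_XaddC.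
have hE : mk_monic h = h by rewrite /mk_monic size_h monic_h.
have p2 : 1 + 1 = 0 :> {poly F} by rewrite -polyC1 -polyCD char2 polyC0.
have xx1 : 'qX * ('qX + 1) = 1 :> {poly %/ h}.
  have E : 'qX * ('qX + 1) = in_qpoly h ('X * ('X + 1)).
    by rewrite rmorphM rmorphD rmorph1.
  have -> : 'qX * ('qX + 1) = in_qpoly h (h + 1).
    by rewrite E; congr in_qpoly; rewrite /h mulrDr mulr1 -expr2 -[LHS]addr0 -p2 addrA.
  have hh : in_qpoly h h = 0.
    by apply/val_inj; rewrite /= hE; apply: Pdiv.RingMonic.rmodpp.
  by apply: etrans (in_qpolyD h h 1) _; rewrite hh in_qpoly1 add0r.
have qE' : q%:R = 1 :> {poly %/ h}.
  by rewrite -[RHS](scale1r (1 : {poly %/ h})) -qE scaler_nat.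
have x1x : (q%:R + 'qX) * 'qX = 1 :> {poly %/ h} by rewrite qE' addrC mulrC.
(* The constant coefficient is linear and sends 1 to 1. The quotient has dimension 2, so the descent
   costs the factor 8 = 2^3. *)
have sc : scalar (fun a : {poly %/ h} => (a : {poly F})`_0).
  by move=> r u v; rewrite poly_of_qpolyD poly_of_qpolyZ coefD coefZ.
have one : ((1 : {poly %/ h}) : {poly F})`_0 = 1 by rewrite coef1.
have := rank_le_descent (T := fun x y z => nat_of_bool (matmul_support x y z)) (@qpoly_sum_coef _ h)
  sc one (rank_le_local_SUSP xx1 x1x localP cardP).
by rewrite hE size_h.
Qed.

End LocalSUSPs.

(** * Cyclic relabelling and powers of a puzzle *)

Definition rotate_symbol (e a : 'I_3) : 'I_3 := inord ((a + e) %% 3).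

Lemma rotate_inj a : injective (rotate_symbol^~ a).
Proof.
move=> e e' /(congr1 val); rewrite /rotate_symbol /= !inordK ?ltn_pmod // => H; apply: val_inj.
by move: H; case: e e' a => -[|[|[|//]]] ? [[|[|[|//]]] ?] [[|[|[|//]]] ?].
Qed.

(** Shifting all symbols cyclically permutes the three conditions among the three rows. *)
Lemma bad_column_rotate e a b c : bad_column (rotate_symbol e a) (rotate_symbol e b) (rotate_symbol e c) =
  match val e with 0 => bad_column a b c | 1 => bad_column b c a | _ => bad_column c a b end.
Proof.
rewrite /bad_column /symbol /rotate_symbol !inordK ?ltn_pmod //.
by case: e a b c => -[|[|[|//]]] ? [[|[|[|//]]] ?] [[|[|[|//]]] ?] [[|[|[|//]]] ?].
Qed.

Section PuzzlePower.
Variables (k : nat) (P : puzzle k) (N : nat).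
Hypothesis susp : simplifiable_SUSP P.
Let U : finType := {u | u \in P}.

(** Without bad columns the triple is an edge of the puzzle graph at every position; equal counts
    let it survive until only the trivial matching is left. *)
Lemma occurrences_class_local (a b c : {ffun 'I_N -> U}) :
  occurrences a = occurrences b -> occurrences b = occurrences c ->
  (forall j i, ~~ bad_column (val (a j) i) (val (b j) i) (val (c j) i)) -> a = b /\ b = c.
Proof.
move=> ab bc good.
have H : in_graph (puzzle_graph P) a b c.
  by move=> j; rewrite inE negb_exists; apply/forallP => i; apply: good.
have := in_graph_simplifies_to ab bc susp H.
by move=> T; split; apply/ffunP => j; case/imsetP: (T j) => u _ [aE bE cE]; rewrite ?aE ?bE ?cE.
Qed.

Variable o : {ffun U -> 'I_#|'I_N|.+1}.
Let W : finType := {a : {ffun 'I_N -> U} | a \in [set a | occurrences a == o]}.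

Let WP (a : W) : occurrences (val a) = o.
Proof. by apply/eqP; have := valP a; rewrite inE. Qed.

(* Concatenating the three cyclic relabellings of three sequences makes all three symbols
   equally frequent, so that the matrices to be multiplied are square. *)
Definition power_row (u : {ffun 'I_3 -> W}) (p : 'I_3 * ('I_N * 'I_k)) : 'I_3 :=
  rotate_symbol p.1 (val (val (u p.1) p.2.1) p.2.2).

(** On each third, relabelling amounts to a cyclic permutation of the triple, and all sequences of
    the class have the same counts. *)
Lemma power_row_local u v w :
  (forall p, ~~ bad_column (power_row u p) (power_row v p) (power_row w p)) -> u = v /\ v = w.
Proof.
move=> good.
suff E e : val (u e) = val (v e) /\ val (v e) = val (w e).
  by split; apply/ffunP => e; apply: val_inj; [exact: (E e).1 | exact: (E e).2].
have {good} good j i := good (e, (j, i)); rewrite /power_row /= in good.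
have {good} : forall j i, ~~ match val e with
    | 0 => bad_column (val (val (u e) j) i) (val (val (v e) j) i) (val (val (w e) j) i)
    | 1 => bad_column (val (val (v e) j) i) (val (val (w e) j) i) (val (val (u e) j) i)
    | _ => bad_column (val (val (w e) j) i) (val (val (u e) j) i) (val (val (v e) j) i) end.
  by move=> j i; have := good j i; rewrite bad_column_rotate.
case: (val e) => [|[|_]] /occurrences_class_local; rewrite !WP.
- exact.
- by case=> // -> ->.
- by case=> // -> ->.
Qed.

(** Each of the [N * k] letters is sent to [c] by exactly one of the three rotations. *)
Lemma card_power_row u c : #|[set p | power_row u p == c]| = N * k.
Proof.
pose G e (x : U) := \sum_i (rotate_symbol e (val x i) == c).
transitivity (\sum_e \sum_j G e (val (u e) j)).
  rewrite -sum1_card big_mkcond /=.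
  rewrite (eq_bigr (fun p => nat_of_bool (rotate_symbol p.1 (val (val (u p.1) p.2.1) p.2.2) == c))); last first.
    by move=> p _; rewrite inE /power_row; case: eqP.
  rewrite -(pair_bigA _ (fun e q => nat_of_bool (rotate_symbol e (val (val (u e) q.1) q.2) == c))) /=.
  apply: eq_bigr => e _.
  by rewrite -(pair_bigA _ (fun j i => nat_of_bool (rotate_symbol e (val (val (u e) j) i) == c))).
(* The sequences [u e] differ with [e]; passing to their common counts [o] lets the sum over [e]
   move inside. *)
under eq_bigr do rewrite sum_occurrences WP.
rewrite exchange_big /=; under eq_bigr do rewrite -big_distrr exchange_big /=.
transitivity (\sum_x o x * k).
  apply: eq_bigr => x _; congr (_ * _); rewrite -[RHS]muln1 -[in RHS](card_ord k) -sum_nat_const.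
  apply: eq_bigr => i _.
  pose d := invF (@rotate_inj (val x i)) c.
  have dP : rotate_symbol d (val x i) = c by exact: (f_invF (@rotate_inj (val x i)) c).
  rewrite -dP (bigD1 d) //= eqxx big1 // => e ne.
  by rewrite (inj_eq (@rotate_inj _)) (negbTE ne).
rewrite -(WP (u ord0)) -(sum_occurrences _ (fun=> k)) sum_nat_const card_ord.
by [].
Qed.

End PuzzlePower.

(** * The program of a bilinear algorithm *)

Local Notation "''v' x" := (IdxVar x) (at level 8, x at level 0).
Local Notation "''c' x" := (IdxConst x) (at level 8, x at level 0).
Local Notation "x +' y" := (IdxBin IdxAdd x y) (at level 50, left associativity).
Local Notation "x -' y" := (IdxBin IdxSub x y) (at level 50, left associativity).
Local Notation "x *' y" := (IdxBin IdxMul x y) (at level 40, left associativity).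
Local Notation "x /' y" := (IdxBin IdxDiv x y) (at level 40, left associativity).
Local Notation "x %' y" := (IdxBin IdxMod x y) (at level 40, left associativity).

Lemma iteri_inv (S : Type) (Inv : nat -> S -> Prop) (f : nat -> S -> S) (n : nat) (s : S) :
  Inv 0 s -> (forall i s', i < n -> Inv i s' -> Inv i.+1 (f i s')) -> Inv n (iteri n f s).
Proof.
move=> I0 step; have : n <= n by [].
by elim: {1 3 4}n => //= m IH lt_m; apply: step => //; apply: IH (ltnW lt_m).
Qed.


Section Program.
Variable F : fieldType.
Implicit Types (st : state F) (p : program F).

(** The table is unrolled, since each constant of [F] needs an instruction of its own. *)
Definition load_table (a : nat) (f : nat -> nat -> F) (s : seq (nat * nat)) : program F :=
  foldr (fun ij p => Seq (LoadConst (Cell a 'c(ij.1) 'c(ij.2)) (f ij.1 ij.2)) p) Skip s.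

Lemma load_tableP a f s st (st' := exec (load_table a f s) st) :
  [/\ index_of st' = index_of st, field_ops st' = field_ops st &
      forall c i j, memory st' (c, i, j) =
        if (c == a) && ((i, j) \in s) then f i j else memory st (c, i, j)].
Proof.
rewrite {}/st'; elim: s st => [|[i0 j0] s IH] st /=; first by split=> // c i j; rewrite andbF.
case: (IH (write (Cell a 'c(i0) 'c(j0)) (f i0 j0) st)) => -> -> memE; split=> // c i j.
rewrite memE /= in_cons !xpair_eqE; case: eqVneq => //= _.
by case: (_ \in s); rewrite ?orbT ?orbF //; case: ifP => // /andP[/eqP-> /eqP->].
Qed.

(** Index variables 5 and 6 are the counters of the nested loops of [dot_stage]. *)
Definition agree (r0 r : nat -> nat) := forall z, z != 5 -> z != 6 -> r z = r0 z.

(** This is the common shape of one level of encoding and of decoding: a row is filled with linear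
    combinations of entries of another row, with coefficients from a table. *)
Definition dot_stage (dst src tab terms : nat)
    (count dst_row src_row coef_row coef_col src_col : index_expr) : program F :=
  For 5 count (Seq (LoadConst (Cell dst dst_row 'v5) 0%R)
    (For 6 'c(terms) (Seq
      (Arith (Cell 9 'c0 'c0) FieldMul (Cell tab coef_row coef_col) (Cell src src_row src_col))
      (Arith (Cell dst dst_row 'v5) FieldAdd (Cell dst dst_row 'v5) (Cell 9 'c0 'c0))))).

(** The side conditions keep the table and the source row apart from the row being written, so every
    read sees the initial memory. Each term costs one multiplication and one addition. *)
Lemma dot_stageP dst src tab terms count dst_row src_row coef_row coef_col src_col st
    (dr sr : nat) (cr cc sc : nat -> nat -> nat)
    (st' := exec (dot_stage dst src tab terms count dst_row src_row coef_row coef_col src_col) st) :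
  (forall r, agree (index_of st) r -> eval_index r dst_row = dr) ->
  (forall r, agree (index_of st) r -> eval_index r src_row = sr) ->
  (forall r, agree (index_of st) r -> eval_index r coef_row = cr (r 5) (r 6)) ->
  (forall r, agree (index_of st) r -> eval_index r coef_col = cc (r 5) (r 6)) ->
  (forall r, agree (index_of st) r -> eval_index r src_col = sc (r 5) (r 6)) ->
  dst != 9 -> tab != 9 -> src != 9 -> tab != dst -> (src != dst) || (sr != dr) ->
  [/\ agree (index_of st) (index_of st'),
      field_ops st' = field_ops st + eval_index (index_of st) count * (terms * 2) &
      forall a i j, a != 9 -> memory st' (a, i, j) =
        if [&& a == dst, i == dr & j < eval_index (index_of st) count]
        then (\sum_(y < terms) memory st (tab, cr j y, cc j y) * memory st (src, sr, sc j y))%R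
        else memory st (a, i, j)].
Proof.
move=> drP srP crP ccP scP dst9 tab9 src9 tab_dst src_dst; rewrite {}/st' /=.
set cnt := eval_index _ count; pose r0 := index_of st.
pose S j m := (\sum_(y < m) memory st (tab, cr j y, cc j y) * memory st (src, sr, sc j y))%R.
pose Inv m s := [/\ agree r0 (index_of s), field_ops s = field_ops st + m * (terms * 2) &
  forall a i j, a != 9 -> memory s (a, i, j) =
    if [&& a == dst, i == dr & j < m] then S j terms else memory st (a, i, j)].
apply: (iteri_inv (Inv := Inv)); first by split=> // [|a i j _]; rewrite ?addn0 // !andbF.
move=> x s _ [ag ops mem].
pose Inv' m (s' : state F) := [/\ agree r0 (index_of s'), index_of s' 5 = x,
  field_ops s' = field_ops s + m * 2 &
  forall a i j, a != 9 -> memory s' (a, i, j) =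
    if [&& a == dst, i == dr & j == x] then S j m else memory s (a, i, j)].
set s1 := write (Cell dst dst_row 'v5) 0%R (set_index 5 x s).
have ag1 : agree r0 (index_of s1) by move=> z z5 z6; rewrite /= (negbTE z5) ag.
rewrite [X in Inv _ X]/=; set s2 := iteri _ _ s1.
suff [ag' _ ops' mem'] : Inv' terms s2.
  split=> //; first by rewrite ops' ops mulSn addnA addnAC.
  move=> a i j a9; rewrite mem' // mem // [in RHS]ltnS [in RHS]leq_eqVlt.
  by case: (a == dst); case: (i == dr); case: (j == x).
apply: (iteri_inv (Inv := Inv')).
  split=> // [|a i j a9]; first by rewrite addn0.
  by rewrite /= !xpair_eqE drP // -andbA /S big_ord0.
move=> y s' _ [ag2 x5 ops2 mem2].
have agr : agree r0 [eta index_of s' with 6 |-> y].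
  by move=> z z5 z6; rewrite /= (negbTE z6) ag2.
rewrite /Inv' /= /read /= !drP // srP // crP // ccP // scP //= x5 !xpair_eqE.
split=> // [|a i j a9].
- by rewrite ops2 mulSnr addnA addn2.
- rewrite !xpair_eqE (negbTE dst9) (negbTE a9) /=.
  rewrite !mem2 // eqxx (negbTE tab_dst) /=.
  have -> : [&& src == dst, sr == dr & sc x y == x] = false.
    by case/orP: src_dst => /negbTE ->; rewrite ?andbF.
  rewrite !mem // (negbTE tab_dst) /=.
  have -> : [&& src == dst, sr == dr & sc x y < x] = false.
    by case/orP: src_dst => /negbTE ->; rewrite ?andbF.
  rewrite !eqxx /= -andbA; case: ifP => [/and3P[_ _ /eqP->]|->//].
  by rewrite /S big_ord_recr.
Qed.

End Program.

(** * Flat indices of families of square matrices *)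

Lemma big_ord_mul (V : nmodType) (p q : nat) (G : nat -> V) :
  (\sum_(x < p * q) G x = \sum_(i < p) \sum_(j < q) G (i * q + j)%N)%R.
Proof.
elim: p => [|p IH]; first by rewrite !big_ord0.
rewrite big_ord_recr /= -IH -(big_mkord xpredT G) -(big_mkord xpredT G) mulSnr.
rewrite (big_cat_nat (n := p * q)) ?leq_addr //=; congr (_ + _)%R.
by rewrite -{1}[p * q]add0n big_addn addKn big_mkord; apply: eq_bigr => j _; rewrite addnC.
Qed.

Lemma flat_index_lt R M c i j : c < R -> i < M -> j < M -> (c * M + i) * M + j < R * (M * M).
Proof.
move=> cR iM jM; rewrite mulnA.
have le1 : c * M + i < R * M.
  by apply: leq_trans (_ : c.+1 * M <= _); rewrite ?leq_mul2r ?cR ?orbT // mulSnr ltn_add2l.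
by apply: leq_trans (_ : (c * M + i).+1 * M <= _); rewrite ?leq_mul2r ?le1 ?orbT // mulSnr ltn_add2l.
Qed.

Lemma flat_divn M c i j : i < M -> j < M ->
  [/\ ((c * M + i) * M + j) %/ M = c * M + i, ((c * M + i) * M + j) %% M = j,
      (c * M + i) %/ M = c & (c * M + i) %% M = i].
Proof.
move=> iM jM; have M0 : 0 < M by apply: leq_ltn_trans iM.
by rewrite !divnMDl // !modnMDl !modn_small // !divn_small // !addn0.
Qed.

(** * Level-by-level encoding and decoding *)

Section Transform.
Variables (F : comNzRingType) (b r L : nat) (ta tb tc : nat -> nat -> F).

(* The flat index x = (c * M + i) * M + j is the entry (i, j) of the c-th of r^d
   matrices of order M = b^(L - d). *)
Fixpoint encode (t : nat -> nat -> F) (A : nat -> nat -> F) (d x : nat) : F :=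
  if d is d'.+1 then
    let M' := b ^ (L - d) in let M := b ^ (L - d') in
    (\sum_(y < b * b) t (x %/ M' %/ M' %% r)%N y * encode t A d'
       ((x %/ M' %/ M' %/ r * M + (y %/ b * M' + x %/ M' %% M')) * M + (y %% b * M' + x %% M'))%N)%R
  else A (x %/ b ^ L) (x %% b ^ L).

(** Here [e] counts upwards from scalars, so the matrices have order [b ^ e]. The first argument of
    [tc] is the position of the entry's block in the [b] by [b] grid. *)
Fixpoint decode (G : nat -> F) (e x : nat) : F :=
  if e is e'.+1 then
    let M' := b ^ e' in let M := b ^ e in
    (\sum_(y < r) tc (x %/ M %% M %/ M' * b + x %% M %/ M')%N y * decode G e'
       (((x %/ M %/ M * r + y) * M' + x %/ M %% M %% M') * M' + x %% M %% M')%N)%R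
  else G x.

(** Induction on the order: the [r] products of encoded blocks are correct by hypothesis, and the
    trilinear identity recombines them into the block matrix product. *)
Lemma decode_encode A B e d c i j :
  0 < b ->
  (forall z z' y, z < b * b -> z' < b * b -> y < b * b ->
     (\sum_(p < r) ta p z * tb p z' * tc y p
      = [&& y %/ b == z %/ b, z %% b == z' %/ b & z' %% b == y %% b]%N%:R)%R) ->
  e + d = L -> i < b ^ e -> j < b ^ e ->
  (decode (fun x => encode ta A L x * encode tb B L x) e ((c * b ^ e + i) * b ^ e + j)%N
   = \sum_(k < b ^ e) encode ta A d ((c * b ^ e + i) * b ^ e + k)%N *
                     encode tb B d ((c * b ^ e + k) * b ^ e + j)%N)%R.
Proof.
move=> b0 trilinear; elim: e d c i j => [|e IH] d c i j.
  rewrite add0n expn0 => -> /[!ltnS] /[!leqn0] /eqP-> /eqP->.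
  by rewrite big_ord_recl big_ord0 /= addr0.
move=> edL iM jM; have {}IH := IH d.+1; rewrite addnS -addSn in IH.
have M'0 : 0 < b ^ e by rewrite expn_gt0 b0.
set M := b ^ e.+1; set M' := b ^ e; have ME : M = b * M' by rewrite /M expnS.
have LdE : L - d = e.+1 by rewrite -edL addnK.
have LdE' : L - d.+1 = e by rewrite -edL addSn -addnS addnK.
have encE t X p c' k l : p < r -> k < M' -> l < M' ->
    (encode t X d.+1 (((c' * r + p) * M' + k) * M' + l)%N =
    \sum_(y < b * b) t p y * encode t X d ((c' * M + (y %/ b * M' + k)) * M + (y %% b * M' + l))%N)%R.
  move=> pr kM lM /=; rewrite LdE LdE' -/M -/M'.
  have [-> -> -> ->] := flat_divn (c' * r + p) kM lM.
  have r0 : 0 < r by apply: leq_ltn_trans pr.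
  by rewrite modnMDl divnMDl // (modn_small pr) (divn_small pr) addn0.
have [/= jE1 jE2 jE3 jE4] := flat_divn c iM jM.
rewrite -/M jE1 jE2 jE3 jE4 -/M'.
set a := i %/ M'; set a' := i %% M'; set f := j %/ M'; set f' := j %% M'.
have ab : a < b by rewrite /a ltn_divLR // -ME.
have fb : f < b by rewrite /f ltn_divLR // -ME.
have a'M : a' < M' by rewrite ltn_pmod.
have f'M : f' < M' by rewrite ltn_pmod.
have y0b : a * b + f < b * b.
  by apply: leq_trans (_ : a.+1 * b <= _); rewrite ?leq_mul2r ?ab ?orbT // mulSnr ltn_add2l.
have yE : (a * b + f) %/ b = a by rewrite divnMDl // divn_small // addn0.
have yE' : (a * b + f) %% b = f by rewrite modnMDl modn_small.
pose EA (z : nat) k' := encode ta A d ((c * M + (z %/ b * M' + a')) * M + (z %% b * M' + k')).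
pose EB (z : nat) k' := encode tb B d ((c * M + (z %/ b * M' + k')) * M + (z %% b * M' + f')).
(* Expanding both encodings and moving the sum over [y] innermost exposes the trilinear sum, whose
   value is an indicator. *)
transitivity (\sum_(k' < M') \sum_(z < b * b) \sum_(z' < b * b) (EA z k' * EB z' k')
     * [&& a == z %/ b, z %% b == z' %/ b & z' %% b == f]%N%:R)%R.
  under eq_bigr => y _.
    rewrite (IH (c * r + y)) //.
    under eq_bigr => k' _ do rewrite !encE // big_distrlr /=.
    rewrite mulr_sumr.
    under eq_bigr => k' _.
      rewrite mulr_sumr; under eq_bigr => z _ do rewrite mulr_sumr.
      over.
    over.
  rewrite exchange_big; apply: eq_bigr => k' _.
  rewrite exchange_big; apply: eq_bigr => z _.
  rewrite exchange_big; apply: eq_bigr => z' _.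
  have T := trilinear z z' (a * b + f) (ltn_ord z) (ltn_ord z') y0b.
  rewrite yE yE' in T; rewrite -T mulr_sumr; apply: eq_bigr => y _.
  by rewrite -/(EA z k') -/(EB z' k') mulrACA [LHS]mulrA (mulrC (tc _ _)) [LHS]mulrC.
have digits (m n : nat) : n < b -> (m * b + n) %/ b = m /\ (m * b + n) %% b = n.
  by move=> nb; rewrite divnMDl // divn_small // addn0 modnMDl modn_small.
have single (a0 : nat) (G : nat -> F) : a0 < b -> (forall z, z < b -> z != a0 -> G z = 0%R) ->
    (\sum_(z < b) G z = G a0)%R.
  move=> a0b G0; rewrite (bigD1 (Ordinal a0b)) //= big1 ?addr0 // => z.
  by rewrite -(inj_eq val_inj) /=; apply: G0.
have := big_ord_mul b M' (fun k =>
  encode ta A d ((c * M + i) * M + k)%N * encode tb B d ((c * M + k) * M + j)%N)%R.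
rewrite -ME => ->; rewrite [RHS]exchange_big /=; apply: eq_bigr => k' _.
pose T z z' : F := (EA z k' * EB z' k' * [&& a == z %/ b, z %% b == z' %/ b & z' %% b == f]%N%:R)%R.
apply: etrans (big_ord_mul b b (fun z => \sum_(z' < b * b) T z z')%R) _.
(* The indicator leaves only [z = a * b + m] and [z' = m * b + f], where [m] runs over the inner
   block index. *)
rewrite (single a (fun z1 => \sum_(z2 < b) \sum_(z' < b * b) T (z1 * b + z2)%N z')%R) //; last first.
  move=> z zb ne; rewrite big1 // => z2 _; rewrite big1 // => z' _; rewrite /T.
  by have [-> _] := digits z z2 (ltn_ord _); rewrite eq_sym (negbTE ne) mulr0.
apply: eq_bigr => m _; rewrite (big_ord_mul b b (T (a * b + m))).
have [dE1 dE2] := digits a m (ltn_ord _).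
rewrite (single m (fun z3 => \sum_(z4 < b) T (a * b + m)%N (z3 * b + z4)%N)%R) ?ltn_ord //; last first.
  move=> z zb ne; rewrite big1 // => z4 _; rewrite /T dE2.
  by have [-> _] := digits z z4 (ltn_ord _); rewrite (eq_sym (m : nat)) (negbTE ne) andbF mulr0.
rewrite (single f (fun z4 => T (a * b + m) (m * b + z4))) //; last first.
  move=> z zb ne; have [_ zE] := digits m z zb.
  by rewrite /T zE (negbTE ne) !andbF mulr0.
have [dE3 dE4] := digits m f fb.
rewrite /T /EA /EB dE1 dE2 dE3 dE4 !eqxx mulr1.
by rewrite /a /a' /f /f' -!divn_eq.
Qed.

End Transform.

(** * The breadth-first program, its correctness and its cost *)

Section BilinearProgram.
Variables (F : fieldType) (b r : nat) (ta tb tc : nat -> nat -> F).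
Hypotheses (b1 : 1 < b) (br : b * b <= r).

Let b0 : 0 < b. Proof. exact: ltnW. Qed.
Let r0 : 0 < r. Proof. by apply: leq_trans br; rewrite muln_gt0 b0. Qed.

(* Index variables: 0 holds n, 1 the number L of levels, 2 the current matrix order, 3 the
   level, 4 the current number of matrices, 5 and 6 positions, 7 the order at the next level.
   Row d of arrays 3, 4, 5 holds level d of the two encodings and of their product; arrays
   6, 7, 8 hold the tables, array 9 a scratch cell. *)
Definition level_loop : program F :=
  Seq (SetIndex 2 'c1) (For 3 'v0 (IfNonzero ('v0 -' 'v2)
    (Seq (SetIndex 2 ('v2 *' 'c b)) (SetIndex 1 ('v1 +' 'c1))) Skip)).

(** Entries outside the input read as 0, so both factors are padded with zeros to order [b ^ L]. *)
Definition copy_inputs : program F :=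
  For 5 ('v2 *' 'v2) (Seq (Copy (Cell 3 'c0 'v5) (Cell 0 ('v5 /' 'v2) ('v5 %' 'v2)))
                          (Copy (Cell 4 'c0 'v5) (Cell 1 ('v5 /' 'v2) ('v5 %' 'v2)))).

Definition encode_stage (a t : nat) : program F :=
  dot_stage F a a t (b * b) ('v4 *' 'c r *' ('v7 *' 'v7)) ('v3 +' 'c1) 'v3
    ('v5 /' 'v7 /' 'v7 %' 'c r) 'v6
    (('v5 /' 'v7 /' 'v7 /' 'c r *' 'v2 +' ('v6 /' 'c b *' 'v7 +' 'v5 /' 'v7 %' 'v7)) *' 'v2
      +' ('v6 %' 'c b *' 'v7 +' 'v5 %' 'v7)).

Definition encode_loop : program F :=
  Seq (SetIndex 4 'c1) (For 3 'v1
    (Seq (SetIndex 7 ('v2 /' 'c b)) (Seq (encode_stage 3 6) (Seq (encode_stage 4 7)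
    (Seq (SetIndex 2 'v7) (SetIndex 4 ('v4 *' 'c r))))))).

Definition multiply_loop : program F :=
  For 5 'v4 (Arith (Cell 5 'v1 'v5) FieldMul (Cell 3 'v1 'v5) (Cell 4 'v1 'v5)).

Definition decode_stage : program F :=
  dot_stage F 5 5 8 r ('v4 *' ('v2 *' 'v2)) ('v1 -' ('v3 +' 'c1)) ('v1 -' 'v3)
    ('v5 /' 'v2 %' 'v2 /' 'v7 *' 'c b +' 'v5 %' 'v2 /' 'v7) 'v6
    ((('v5 /' 'v2 /' 'v2 *' 'c r +' 'v6) *' 'v7 +' 'v5 /' 'v2 %' 'v2 %' 'v7) *' 'v7
      +' 'v5 %' 'v2 %' 'v7).

Definition decode_loop : program F :=
  For 3 'v1 (Seq (SetIndex 7 'v2) (Seq (SetIndex 2 ('v2 *' 'c b))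
    (Seq (SetIndex 4 ('v4 /' 'c r)) decode_stage))).

Definition copy_output : program F :=
  For 5 ('v2 *' 'v2) (Copy (Cell 2 ('v5 /' 'v2) ('v5 %' 'v2)) (Cell 5 'c0 'v5)).

Definition load_tables : program F :=
  let rows := [seq (i, j) | i <- iota 0 r, j <- iota 0 (b * b)] in
  let columns := [seq (i, j) | i <- iota 0 (b * b), j <- iota 0 r] in
  Seq (load_table 6 ta rows) (Seq (load_table 7 tb rows) (load_table 8 tc columns)).

Definition bilinear_program : program F :=
  Seq load_tables (Seq level_loop (Seq copy_inputs (Seq encode_loop
    (Seq multiply_loop (Seq decode_loop copy_output))))).

Definition tables_loaded (st : state F) := forall p y, p < r -> y < b * b ->
  [/\ memory st (6, p, y) = ta p y, memory st (7, p, y) = tb p y & memory st (8, y, p) = tc y p].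

Lemma load_tablesP st (st' := exec load_tables st) :
  [/\ tables_loaded st', index_of st' = index_of st, field_ops st' = field_ops st &
      forall c i j, c < 6 -> memory st' (c, i, j) = memory st (c, i, j)].
Proof.
pose rows := [seq (i, j) | i <- iota 0 r, j <- iota 0 (b * b)].
pose columns := [seq (i, j) | i <- iota 0 (b * b), j <- iota 0 r].
pose s1 := exec (load_table 6 ta rows) st; pose s2 := exec (load_table 7 tb rows) s1.
pose s3 := exec (load_table 8 tc columns) s2.
rewrite {}/st' -[exec load_tables st]/s3.
have [i1 o1 m1] : [/\ index_of s1 = _, field_ops s1 = _ & _] := load_tableP 6 ta rows st.
have [i2 o2 m2] : [/\ index_of s2 = _, field_ops s2 = _ & _] := load_tableP 7 tb rows s1.
have [i3 o3 m3] : [/\ index_of s3 = _, field_ops s3 = _ & _] := load_tableP 8 tc columns s2.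
split; [|by rewrite i3 i2|by rewrite o3 o2|].
  move=> p y pr yb.
  have rowsP : (p, y) \in rows by apply/allpairsP; exists (p, y); rewrite !mem_iota.
  have columnsP : (y, p) \in columns by apply/allpairsP; exists (y, p); rewrite !mem_iota.
  by rewrite !m3 !m2 !m1 /= rowsP columnsP.
by move=> c i j c6; rewrite m3 m2 m1; move: c6; case: c => [|[|[|[|[|[|]]]]]].
Qed.

(** Truncated subtraction makes the test mean that the order is still below [n]; [n] rounds suffice
    because [n < b ^ n]. *)
Lemma level_loopP st (st' := exec level_loop st) (n := index_of st 0) :
  index_of st 1 = 0 ->
  [/\ index_of st' 1 = up_log b n, index_of st' 2 = b ^ up_log b n,
      field_ops st' = field_ops st & memory st' = memory st].
Proof.
move=> l0; rewrite {}/st' /= -/n.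
pose Inv i (s : state F) := [/\ index_of s 0 = n /\ index_of s 2 = b ^ index_of s 1,
  index_of s 1 <= up_log b n, i <= index_of s 1 \/ index_of s 1 = up_log b n &
  field_ops s = field_ops st /\ memory s = memory st].
set s' := iteri _ _ _; suff [[_ E] le cases [-> ->]] : Inv n s'.
  suff lE : index_of s' 1 = up_log b n by rewrite E lE.
  case: cases => // le'; apply/eqP; rewrite eqn_leq le (leq_trans _ le') //.
  by rewrite up_log_min // ltnW // ltn_expl.
apply: (iteri_inv (Inv := Inv)); first by split; rewrite /= ?l0 //; left.
move=> i s _ [[n0 E] le cases [eo em]] /=.
rewrite n0 E; case: ifP => /= [|/negbFE/eqP/eqP].
  rewrite subn_eq0 -ltnNge => lt; have lt' : index_of s 1 < up_log b n.
    by rewrite ltnNge; apply: contraL lt => le'; rewrite -leqNgt (leq_trans (up_logP n b1)) // leq_exp2l.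
  split=> /=; rewrite ?addn1 ?expnSr //.
  by case: cases => [le'|eq]; [left; exact: le' | rewrite eq ltnn in lt'].
rewrite subn_eq0 => nle; split => //; right; apply/eqP; rewrite eqn_leq le /=.
exact: up_log_min.
Qed.

Lemma copy_inputsP st (st' := exec copy_inputs st) (M := index_of st 2) :
  [/\ forall x, x != 5 -> index_of st' x = index_of st x, field_ops st' = field_ops st,
      forall x, x < M * M -> memory st' (3, 0, x) = memory st (0, x %/ M, x %% M) /\
                             memory st' (4, 0, x) = memory st (1, x %/ M, x %% M) &
      forall c i j, c != 3 -> c != 4 -> memory st' (c, i, j) = memory st (c, i, j)].
Proof.
rewrite {}/st' /= -/M.
pose Inv m (s : state F) := [/\ forall x, x != 5 -> index_of s x = index_of st x,
  field_ops s = field_ops st,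
  forall x, x < m -> memory s (3, 0, x) = memory st (0, x %/ M, x %% M) /\
                     memory s (4, 0, x) = memory st (1, x %/ M, x %% M) &
  forall c i j, c != 3 -> c != 4 -> memory s (c, i, j) = memory st (c, i, j)].
apply: (iteri_inv (Inv := Inv)); first by split.
move=> m s _ [ix os ms ks]; split=> /=.
- by move=> x x5; rewrite (negbTE x5) ix.
- by [].
- move=> x; rewrite ltnS leq_eqVlt => /orP[/eqP-> | lt].
    by rewrite !xpair_eqE !eqxx /= !ks // ix.
  by rewrite !xpair_eqE (ltn_eqF lt) /=; apply: ms.
- by move=> c i j c3 c4; rewrite !xpair_eqE (negbTE c3) (negbTE c4) /= ks.
Qed.

(** Because [b * b <= r], no level has more than [r ^ L] entries. *)
Let sq_exp_le e : b ^ e * b ^ e <= r ^ e.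
Proof. by rewrite -expnMn; case: e => // e; rewrite leq_exp2r. Qed.

Let level_size_le L d : d < L -> r ^ d * r * (b ^ (L - d.+1) * b ^ (L - d.+1)) <= r ^ L.
Proof.
move=> dL; have -> : r ^ L = r ^ d.+1 * r ^ (L - d.+1) by rewrite -expnD subnKC.
by rewrite -expnSr leq_mul2l sq_exp_le orbT.
Qed.

Lemma encode_stageP (a t L d : nat) (tt A : nat -> nat -> F) st (st' := exec (encode_stage a t) st) :
  a < 9 -> t < 9 -> t != a -> d < L ->
  index_of st 2 = b ^ (L - d) -> index_of st 3 = d -> index_of st 4 = r ^ d ->
  index_of st 7 = b ^ (L - d.+1) ->
  (forall p y, p < r -> y < b * b -> memory st (t, p, y) = tt p y) ->
  (forall x, x < r ^ d * (b ^ (L - d) * b ^ (L - d)) -> memory st (a, d, x) = encode b r L tt A d x) ->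
  [/\ agree (index_of st) (index_of st'), field_ops st' <= field_ops st + 2 * (r * r ^ L),
      forall x, x < r ^ d.+1 * (b ^ (L - d.+1) * b ^ (L - d.+1)) ->
        memory st' (a, d.+1, x) = encode b r L tt A d.+1 x &
      forall c i j, c != 9 -> c != a -> memory st' (c, i, j) = memory st (c, i, j)].
Proof.
move=> a9 t9 ta_ dL v2 v3 v4 v7 tabE memE.
have M'0 : 0 < b ^ (L - d.+1) by rewrite expn_gt0 b0.
set M' := b ^ (L - d.+1) in v7 M'0 *; set M := b ^ (L - d) in v2 memE *.
have ME : M = b * M' by rewrite /M -[L - d]prednK ?subn_gt0 // expnS -subnS.
pose row (x y : nat) := x %/ M' %/ M' %% r.
pose src x y := (x %/ M' %/ M' %/ r * M + (y %/ b * M' + x %/ M' %% M')) * M + (y %% b * M' + x %% M').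
have [ag ops mem] : [/\ agree (index_of st) (index_of st'), field_ops st' = _ &
    forall c i j, c != 9 -> memory st' (c, i, j) = _] :=
  @dot_stageP F a a t (b * b) ('v4 *' 'c r *' ('v7 *' 'v7)) ('v3 +' 'c1) 'v3
    ('v5 /' 'v7 /' 'v7 %' 'c r) 'v6
    (('v5 /' 'v7 /' 'v7 /' 'c r *' 'v2 +' ('v6 /' 'c b *' 'v7 +' 'v5 /' 'v7 %' 'v7)) *' 'v2
      +' ('v6 %' 'c b *' 'v7 +' 'v5 %' 'v7)) st d.+1 d row (fun _ y => y) src
    (fun q Hq => etrans (congr2 addn (etrans (Hq 3 isT isT) v3) (erefl 1)) (addn1 d))
    (fun q Hq => etrans (Hq 3 isT isT) v3)
    ltac:(by move=> q Hq; rewrite /= !(Hq 7) // v7)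
    (fun q Hq => erefl)
    ltac:(by move=> q Hq; rewrite /= !(Hq 7) // !(Hq 2) // v7 v2)
    (negbT (ltn_eqF a9)) (negbT (ltn_eqF t9)) (negbT (ltn_eqF a9)) ta_
    ltac:(by rewrite orbC neq_ltn ltnSn).
clearbody st'; rewrite /= v4 v7 in ops mem.
split=> // [|x lt|c i j c9 ca]; last by rewrite mem // (negbTE ca).
  (* At most [r ^ L] entries are written, each with [b * b <= r] terms of two operations. *)
  rewrite ops leq_add2l [leqRHS]mulnA [leqRHS]mulnC.
  by apply: leq_mul (level_size_le dL) _; rewrite mulnC leq_mul2l.
rewrite mem; last by rewrite neq_ltn a9.
rewrite !eqxx /= -expnSr lt; apply: eq_bigr => y _.
rewrite tabE ?ltn_pmod //; congr (_ * _)%R; apply: memE; rewrite /src -/M'.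
have small (z : nat) w : z < b -> w < M' -> z * M' + w < M.
  move=> zb wM; rewrite ME; apply: leq_trans (_ : z.+1 * M' <= _); last by rewrite leq_mul2r zb orbT.
  by rewrite mulSnr ltn_add2l.
apply: flat_index_lt; last 2 first.
- by apply: small; rewrite ?ltn_divLR ?ltn_pmod.
- by apply: small; rewrite ?ltn_pmod.
by rewrite !ltn_divLR // -expnSr -mulnA.
Qed.

Lemma encode_loopP L A B st (st' := exec encode_loop st) :
  tables_loaded st -> index_of st 1 = L -> index_of st 2 = b ^ L ->
  (forall x, x < b ^ L * b ^ L -> memory st (3, 0, x) = encode b r L ta A 0 x /\
                                  memory st (4, 0, x) = encode b r L tb B 0 x) ->
  [/\ tables_loaded st', index_of st' 1 = L /\ index_of st' 2 = 1 /\ index_of st' 4 = r ^ L,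
      field_ops st' <= field_ops st + L * (4 * (r * r ^ L)) &
      forall x, x < r ^ L -> memory st' (3, L, x) = encode b r L ta A L x /\
                             memory st' (4, L, x) = encode b r L tb B L x].
Proof.
move=> tabs v1 v2 mem0; rewrite {}/st' /=.
pose Inv d (s : state F) := [/\ tables_loaded s,
  index_of s 1 = L /\ index_of s 2 = b ^ (L - d) /\ index_of s 4 = r ^ d,
  field_ops s <= field_ops st + d * (4 * (r * r ^ L)) &
  forall x, x < r ^ d * (b ^ (L - d) * b ^ (L - d)) ->
    memory s (3, d, x) = encode b r L ta A d x /\ memory s (4, d, x) = encode b r L tb B d x].
have step d s : d < L -> Inv d s -> Inv d.+1 (exec
    (Seq (SetIndex 7 ('v2 /' 'c b)) (Seq (encode_stage 3 6) (Seq (encode_stage 4 7)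
    (Seq (SetIndex 2 'v7) (SetIndex 4 ('v4 *' 'c r)))))) (set_index 3 d s)).
  move=> dL [tab [w1 [w2 w4]] ops mem].
  pose s1 := set_index 7 (index_of s 2 %/ b) (set_index 3 d s).
  pose s2 := exec (encode_stage 3 6) s1; pose s3 := exec (encode_stage 4 7) s2.
  have v7 : index_of s1 7 = b ^ (L - d.+1).
    by rewrite /= w2 -[L - d]prednK ?subn_gt0 // expnS -subnS mulKn.
  have [ag2 ops2 mem2 keep2] : [/\ agree (index_of s1) (index_of s2), field_ops s2 <= _,
      forall x, _ -> memory s2 _ = _ & forall c i j, _ -> _ -> memory s2 (c, i, j) = _] :=
    @encode_stageP 3 6 L d ta A s1 isT isT isT dL w2 erefl w4 v7
      (fun p y pr yb => let: And3 E _ _ := tab p y pr yb in E) (fun x lt => (mem x lt).1).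
  have tab2 p y : p < r -> y < b * b -> memory s2 (7, p, y) = tb p y.
    by move=> pr yb; rewrite keep2 //; case: (tab p y pr yb).
  have in2 x : x < r ^ d * (b ^ (L - d) * b ^ (L - d)) -> memory s2 (4, d, x) = encode b r L tb B d x.
    by move=> lt; rewrite keep2 //; case: (mem x lt).
  have [ag3 ops3 mem3 keep3] : [/\ agree (index_of s2) (index_of s3), field_ops s3 <= _,
      forall x, _ -> memory s3 _ = _ & forall c i j, _ -> _ -> memory s3 (c, i, j) = _] :=
    @encode_stageP 4 7 L d tb B s2 isT isT isT dL (etrans (ag2 2 isT isT) w2) (ag2 3 isT isT)
      (etrans (ag2 4 isT isT) w4) (etrans (ag2 7 isT isT) v7) tab2 in2.
  rewrite [exec _ _]/(set_index 4 (index_of s3 4 * r) (set_index 2 (index_of s3 7) s3)).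
  split=> /=.
  - by move=> p y pr yb; rewrite !keep3 ?keep2 //; exact: (tab p y pr yb).
  - by rewrite !ag3 // !ag2 //= w1 w4 -expnSr; split => //; split => //; exact: v7.
  - by move: ops ops2 ops3 => /=; set C := r * r ^ L; lia.
  - by move=> x lt; rewrite mem3 // keep3 // mem2.
have [] : Inv L (iteri L (fun i s => exec (Seq (SetIndex 7 ('v2 /' 'c b))
    (Seq (encode_stage 3 6) (Seq (encode_stage 4 7)
    (Seq (SetIndex 2 'v7) (SetIndex 4 ('v4 *' 'c r)))))) (set_index 3 i s)) (set_index 4 1 st)).
  apply: (iteri_inv (Inv := Inv)) => //.
  by split; rewrite ?subn0 ?addn0 // mul1n.
by rewrite v1 subnn expn0 !muln1 => *; split.
Qed.

Lemma multiply_loopP L R st (st' := exec multiply_loop st) :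
  index_of st 1 = L -> index_of st 4 = R ->
  [/\ forall x, x != 5 -> index_of st' x = index_of st x, field_ops st' = field_ops st + R,
      forall x, x < R -> memory st' (5, L, x) = (memory st (3, L, x) * memory st (4, L, x))%R &
      forall c i j, c != 5 -> memory st' (c, i, j) = memory st (c, i, j)].
Proof.
move=> v1 v4; rewrite {}/st' /= v4.
pose Inv m (s : state F) := [/\ forall x, x != 5 -> index_of s x = index_of st x,
  field_ops s = field_ops st + m,
  forall x, x < m -> memory s (5, L, x) = (memory st (3, L, x) * memory st (4, L, x))%R &
  forall c i j, c != 5 -> memory s (c, i, j) = memory st (c, i, j)].
apply: (iteri_inv (Inv := Inv)); first by split; rewrite ?addn0.
move=> m s _ [ix os ms ks]; split=> /=.
- by move=> x x5; rewrite (negbTE x5) ix.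
- by rewrite os addnS.
- move=> x; rewrite ltnS leq_eqVlt ix // v1 => /orP[/eqP-> | lt].
    by rewrite /read /= !xpair_eqE !eqxx /= !ks // ix // v1.
  by rewrite !xpair_eqE (ltn_eqF lt) andbF; apply: ms.
- by move=> c i j c5; rewrite !xpair_eqE (negbTE c5) /= ks.
Qed.

Lemma copy_outputP st (st' := exec copy_output st) (M := index_of st 2) :
  [/\ field_ops st' = field_ops st &
      forall i j, i < M -> j < M -> memory st' (2, i, j) = memory st (5, 0, i * M + j)].
Proof.
rewrite {}/st' /= -/M.
pose Inv m (s : state F) := [/\ index_of s 2 = M, field_ops s = field_ops st,
  forall x, x < m -> memory s (2, x %/ M, x %% M) = memory st (5, 0, x) &
  forall c i j, c != 2 -> memory s (c, i, j) = memory st (c, i, j)].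
set s' := iteri _ _ _; suff [_ -> mem _] : Inv (M * M) s'.
  split=> // i j iM jM; have M0 : 0 < M by apply: leq_ltn_trans iM.
  rewrite -mem; first by rewrite divnMDl // divn_small // addn0 modnMDl modn_small.
  by apply: leq_trans (_ : i.+1 * M <= _); rewrite ?leq_mul2r ?iM ?orbT // mulSnr ltn_add2l.
apply: (iteri_inv (Inv := Inv)); first by split.
move=> m s _ [i2 os ms ks]; split=> //=.
- move=> x; rewrite ltnS leq_eqVlt i2 => /orP[/eqP-> | lt].
    by rewrite !xpair_eqE !eqxx /= /read /= ks.
  (* Quotient and remainder by [M] determine the position, so earlier outputs are not
     overwritten. *)
  rewrite !xpair_eqE /=; case: andP => [[/eqP E1 /eqP E2]|_]; last exact: ms.
  by have := ltn_eqF lt; rewrite (divn_eq x M) (divn_eq m M) E1 E2 eqxx.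
- by move=> c i j c2; rewrite !xpair_eqE (negbTE c2) /= ks.
Qed.

Let final_size_le L e : e <= L -> r ^ (L - e) * (b ^ e * b ^ e) <= r ^ L.
Proof.
move=> eL; have -> : r ^ L = r ^ (L - e) * r ^ e by rewrite -expnD subnK.
by rewrite leq_mul2l sq_exp_le orbT.
Qed.

(** Step [e] reads row [L - e] of array 5 and writes row [L - e.+1]; the order grows by the factor
    [b] while the number of matrices shrinks by [r]. *)
Lemma decode_loopP (L : nat) (G : nat -> F) st (st' := exec decode_loop st) :
  tables_loaded st -> index_of st 1 = L -> index_of st 2 = 1 -> index_of st 4 = r ^ L ->
  (forall x, x < r ^ L -> memory st (5, L, x) = G x) ->
  [/\ index_of st' 2 = b ^ L, field_ops st' <= field_ops st + L * (2 * (r * r ^ L)) &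
      forall x, x < b ^ L * b ^ L -> memory st' (5, 0, x) = decode b r tc G L x].
Proof.
move=> tabs v1 v2 v4 memG; pose body i s := exec (Seq (SetIndex 7 'v2) (Seq (SetIndex 2 ('v2 *' 'c b))
  (Seq (SetIndex 4 ('v4 /' 'c r)) decode_stage))) (set_index 3 i s).
have {st'}-> : st' = iteri L body st by rewrite -v1.
pose Inv e (s : state F) := [/\ tables_loaded s,
  index_of s 1 = L /\ index_of s 2 = b ^ e /\ index_of s 4 = r ^ (L - e),
  field_ops s <= field_ops st + e * (2 * (r * r ^ L)) &
  forall x, x < r ^ (L - e) * (b ^ e * b ^ e) -> memory s (5, L - e, x) = decode b r tc G e x].
suff [_ [_ [i2 _]] ops mem] : Inv L (iteri L body st).
  by split=> // x lt; have := mem x; rewrite subnn expn0 mul1n => ->.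
apply: (iteri_inv (Inv := Inv)).
  by split; rewrite ?subn0 ?addn0 // expn0 !muln1.
move=> e s eL [tab [w1 [w2 w4]] ops mem].
pose s1 := set_index 4 (index_of s 4 %/ r) (set_index 2 (index_of s 2 * b)
  (set_index 7 (index_of s 2) (set_index 3 e s))).
pose s2 := exec decode_stage s1.
rewrite -[body e s]/s2.
have M'0 : 0 < b ^ e by rewrite expn_gt0 b0.
have u1 : index_of s1 1 = L by [].
have u2 : index_of s1 2 = b ^ e.+1 by rewrite /= w2 expnSr.
have u3 : index_of s1 3 = e by [].
have u4 : index_of s1 4 = r ^ (L - e.+1).
  by rewrite /= w4 -[L - e]prednK ?subn_gt0 // expnS -subnS mulKn.
have u7 : index_of s1 7 = b ^ e by [].
set M' := b ^ e in u7 M'0 mem w2 *; set M := b ^ e.+1 in u2 *.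
have ME : M = b * M' by rewrite /M expnS.
have M0 : 0 < M by rewrite expn_gt0 b0.
pose row (x y : nat) := x %/ M %% M %/ M' * b + x %% M %/ M'.
pose src x y := ((x %/ M %/ M * r + y) * M' + x %/ M %% M %% M') * M' + x %% M %% M'.
have [ag ops2 mem2] : [/\ agree (index_of s1) (index_of s2), field_ops s2 = _ &
    forall c i j, c != 9 -> memory s2 (c, i, j) = _] :=
  @dot_stageP F 5 5 8 r ('v4 *' ('v2 *' 'v2)) ('v1 -' ('v3 +' 'c1)) ('v1 -' 'v3)
    ('v5 /' 'v2 %' 'v2 /' 'v7 *' 'c b +' 'v5 %' 'v2 /' 'v7) 'v6
    ((('v5 /' 'v2 /' 'v2 *' 'c r +' 'v6) *' 'v7 +' 'v5 /' 'v2 %' 'v2 %' 'v7) *' 'v7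
      +' 'v5 %' 'v2 %' 'v7) s1 (L - e.+1) (L - e) row (fun _ y => y) src
    ltac:(by move=> q Hq; rewrite /= (Hq 1) // (Hq 3) // u1 u3 addn1)
    ltac:(by move=> q Hq; rewrite /= (Hq 1) // (Hq 3) // u1 u3)
    ltac:(by move=> q Hq; rewrite /= !(Hq 7) // !(Hq 2) // u7 u2)
    (fun q Hq => erefl)
    ltac:(by move=> q Hq; rewrite /= !(Hq 7) // !(Hq 2) // u7 u2)
    isT isT isT isT ltac:(by rewrite subnS orFb neq_ltn orbC ltn_predL subn_gt0 eL).
have cntE : eval_index (index_of s1) ('v4 *' ('v2 *' 'v2)) = r ^ (L - e.+1) * (M * M).
  by rewrite -u4 -u2.
clearbody s2; rewrite cntE in ops2 mem2.
split.
- by move=> p y pr yb; rewrite !mem2 //; exact: (tab p y pr yb).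
- by rewrite !ag // u1 u2 u4.
- have := leq_mul (final_size_le eL) (leqnn (r * 2)); rewrite -/M; move: ops ops2 => /=.
  set C := r ^ L; set D := r ^ (L - e.+1) * (M * M); move=> o1 -> o2.
  rewrite mulSnr addnA; apply: leq_add o1 (leq_trans o2 _).
  by rewrite mulnC [r * 2]mulnC mulnA.
move=> x lt; rewrite mem2 // !eqxx lt /=; apply: eq_bigr => y _.
have small z : z < M -> z %/ M' < b by move=> zM; rewrite ltn_divLR // -ME.
have row_lt : row x y < b * b.
  rewrite /row; apply: leq_trans (_ : (x %/ M %% M %/ M').+1 * b <= _).
    by rewrite mulSnr ltn_add2l small ?ltn_pmod.
  by rewrite leq_mul2r small ?ltn_pmod ?orbT.
case: (tab y (row x y) (ltn_ord y) row_lt) => _ _ ->; congr (_ * _)%R.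
apply: mem; rewrite /src; apply: flat_index_lt; rewrite ?ltn_pmod //.
have -> : r ^ (L - e) = r ^ (L - e.+1) * r by rewrite -expnSr subnSK.
apply: leq_trans (_ : (x %/ M %/ M).+1 * r <= _); first by rewrite mulSnr ltn_add2l.
by rewrite leq_mul2r !ltn_divLR // -mulnA lt orbT.
Qed.

(** In units of [r * r ^ L], encoding costs at most [4 * L], decoding [2 * L], and the entrywise
    products at most 1. *)
Lemma bilinear_programP :
  (forall z z' y, z < b * b -> z' < b * b -> y < b * b ->
     (\sum_(p < r) ta p z * tb p z' * tc y p
      = [&& y %/ b == z %/ b, z %% b == z' %/ b & z' %% b == y %% b]%N%:R)%R) ->
  multiplies_matrices_in_time bilinear_program
    (fun n => (6 * up_log b n).+1 * (r * r ^ up_log b n)).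
Proof.
move=> trilinear n A B; set final := exec _ _; set L := up_log b n.
pose s0 := initial_state A B.
pose s1 := exec load_tables s0.
pose s2 := exec level_loop s1; pose s3 := exec copy_inputs s2.
pose s4 := exec encode_loop s3; pose s5 := exec multiply_loop s4.
pose s6 := exec decode_loop s5; pose s7 := exec copy_output s6.
have -> : final = s7 by [].
have [tab1 i1 o1 m1] : [/\ tables_loaded s1, index_of s1 = _, field_ops s1 = _ &
  forall c i j, _ -> memory s1 (c, i, j) = _] := load_tablesP s0.
have [v1 v2 o2 m2] : [/\ index_of s2 1 = _, index_of s2 2 = _, field_ops s2 = _ & memory s2 = _] :=
  level_loopP (congr1 (fun f => f 1) i1).
have [i3 o3 m3 k3] : [/\ forall x, _ -> index_of s3 x = _, field_ops s3 = _,
  forall x, _ -> memory s3 (3, 0, x) = _ /\ memory s3 (4, 0, x) = _ &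
  forall c i j, _ -> _ -> memory s3 (c, i, j) = _] := copy_inputsP s2.
rewrite i1 /= -/L in v1 v2; rewrite v2 in m3.
have tab3 : tables_loaded s3.
  by move=> p y pr yb; rewrite !k3 // m2; apply: tab1.
have in3 x : x < b ^ L * b ^ L -> memory s3 (3, 0, x) = encode b r L ta (entry A) 0 x /\
    memory s3 (4, 0, x) = encode b r L tb (entry B) 0 x.
  by move=> lt; case: (m3 x lt) => -> ->; rewrite m2 !m1.
have [tab4 [w1 [w2 w4]] o4 m4] : [/\ tables_loaded s4,
    index_of s4 1 = L /\ index_of s4 2 = 1 /\ index_of s4 4 = r ^ L, field_ops s4 <= _ &
    forall x, _ -> memory s4 (3, L, x) = _ /\ memory s4 (4, L, x) = _] :=
  encode_loopP tab3 (etrans (i3 1 isT) v1) (etrans (i3 2 isT) v2) in3.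
have [i5 o5 m5 k5] : [/\ forall x, _ -> index_of s5 x = _, field_ops s5 = _,
  forall x, _ -> memory s5 (5, L, x) = _ & forall c i j, _ -> memory s5 (c, i, j) = _] :=
  multiply_loopP w1 w4.
have tab5 : tables_loaded s5.
  by move=> p y pr yb; rewrite !k5 //; apply: tab4.
have in5 x : x < r ^ L -> memory s5 (5, L, x) =
    (encode b r L ta (entry A) L x * encode b r L tb (entry B) L x)%R.
  by move=> lt; rewrite m5 //; case: (m4 x lt) => -> ->.
have [v6 o6 m6] : [/\ index_of s6 2 = b ^ L, field_ops s6 <= _ &
    forall x, _ -> memory s6 (5, 0, x) = _] :=
  decode_loopP tab5 (etrans (i5 1 isT) w1) (etrans (i5 2 isT) w2) (etrans (i5 4 isT) w4) in5.
have [o7 m7] : field_ops s7 = _ /\ forall i j, _ -> _ -> memory s7 (2, i, j) = _ := copy_outputP s6.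
split; last first.
  rewrite o7; move: o6 o4; rewrite o5 o3 o2 o1 /= -/L.
  have : r ^ L <= r * r ^ L by rewrite leq_pmull.
  by rewrite mulSn; set C := r * r ^ L; lia.
move=> i j; have nM : n <= b ^ L by apply: up_logP.
have lt (k : 'I_n) : k < b ^ L by apply: leq_trans nM.
have ijM : i * b ^ L + j < b ^ L * b ^ L.
  by apply: leq_trans (_ : i.+1 * b ^ L <= _); rewrite ?leq_mul2r ?lt ?orbT // mulSnr ltn_add2l.
rewrite m7 ?v6 // m6 //.
have := @decode_encode F b r L ta tb tc (entry A) (entry B) L 0 0 i j
  b0 trilinear (addn0 L) (lt i) (lt j).
rewrite mul0n add0n => ->; rewrite mxE.
have lin k : k < b ^ L -> encode b r L ta (entry A) 0 (i * b ^ L + k) = entry A i k.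
  by move=> kM /=; rewrite divnMDl ?divn_small ?addn0 ?modnMDl ?modn_small // expn_gt0 b0.
transitivity (\sum_(k < b ^ L) (entry A i k * entry B k j)%R)%R.
  apply: eq_bigr => k _; rewrite lin //= divnMDl ?expn_gt0 ?b0 // divn_small // addn0.
  by rewrite modnMDl modn_small.
(* Summands with [k >= n] come from the zero padding. *)
rewrite (bigID (fun k : 'I__ => k < n)) /= [X in (_ + X)%R]big1 ?addr0; last first.
  move=> k kn; have kN : (insub (k : nat) : option 'I_n) = None by rewrite insubN.
  by rewrite /entry valK kN mul0r.
rewrite -(big_ord_widen (b ^ L) (fun k => entry A i k * entry B k j)%R nM).
by apply: eq_bigr => k _; rewrite /entry !valK.
Qed.

End BilinearProgram.

Lemma rank_le_algorithm (F : fieldType) (b r : nat) :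
  1 < b -> rank_le (@matmul_copies F 'I_1 'I_b) r ->
  exists p : program F,
    multiplies_matrices_in_time p (fun n => (6 * up_log b n).+1 * (r * r ^ up_log b n)).
Proof.
move=> b1 rk; have br := leq_rank_matmul rk; case: rk => [f [g [h TE]]].
case: b b1 f g h TE br => [//|b] b1 f g h TE br.
case: r f g h TE br => [|r] f g h TE br; first by rewrite leqn0 muln_eq0 in br.
pose tab (f : 'I_r.+1 -> 'I_1 * 'I_b.+1 * 'I_b.+1 -> F) (p z : nat) :=
  f (inord p) (ord0, inord (z %/ b.+1), inord (z %% b.+1)).
(* Quotient and remainder are swapped because the third factor is indexed by the transposed
   product. *)
pose tabT (y p : nat) := h (inord p) (ord0, inord (y %% b.+1), inord (y %/ b.+1)).
exists (bilinear_program b.+1 r.+1 (tab f) (tab g) tabT).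
apply: bilinear_programP => // z z' y zb z'b yb.
have lt_div x : x < b.+1 * b.+1 -> x %/ b.+1 < b.+1 by rewrite ltn_divLR.
have lt_mod x : x %% b.+1 < b.+1 by rewrite ltn_pmod.
transitivity (matmul_copies F
  (ord0 : 'I_1, inord (z %/ b.+1) : 'I_b.+1, inord (z %% b.+1) : 'I_b.+1)
  (ord0, inord (z' %/ b.+1), inord (z' %% b.+1)) (ord0, inord (y %% b.+1), inord (y %/ b.+1))).
  by rewrite TE; apply: eq_bigr => p _; rewrite /tab /tabT inord_val.
have inordE (x x' : nat) : x < b.+1 -> x' < b.+1 -> (inord x == inord x' :> 'I_b.+1) = (x == x').
  by move=> xb x'b; rewrite -(inj_eq val_inj) /= !inordK.
rewrite /matmul_copies /= !inordE ?lt_div ?lt_mod // [y %/ _ == _]eq_sym.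
by congr (_%:R)%R; congr nat_of_bool; case: (_ == _); case: (_ == _); case: (_ == _).
Qed.

(** * From a simplifiable SUSP to an algorithm *)

Section SimplifiableRank.
Variables (k : nat) (P : puzzle k) (N q : nat).
Hypotheses (susp : simplifiable_SUSP P) (N0 : 0 < N) (k0 : 0 < k) (q1 : 1 < q).

(** [w] is the size of a largest-enough occurrence class; rows are triples of its members, whence
    [w ^ 3] copies and [3 * (N * k)] columns. *)
Lemma simplifiable_SUSP_rank (F : fieldType) :
  exists w, [/\ #|P| ^ N <= w * N.+1 ^ #|P|, w <= q.+1 ^ (N * k) &
    rank_le (@matmul_copies F 'I_(w ^ 3) 'I_(q ^ (N * k))) (8 * q.+1 ^ (3 * (N * k)))].
Proof.
have cardU : #|{: {u | u \in P}}| = #|P| by rewrite card_sig.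
have [o] := large_occurrence_class {u | u \in P} 'I_N.
set W := [set a | _]; rewrite cardU card_ord => large.
exists #|W|; split => //.
  apply: leq_trans (max_card _) _; rewrite card_ffun cardU card_ord mulnC expnM.
  rewrite leq_exp2r //; apply: leq_trans (max_card _) _.
  by rewrite card_ffun !card_ord leq_exp2r.
have Nk0 : 0 < N * k by rewrite muln_gt0 N0.
have count u c : #|[set p | @power_row k P N o u p == c]| = (N * k).-1.+1.
  by rewrite card_power_row prednK.
have := rank_le_local_SUSP_field F q (@power_row_local k P N susp o) count.
have cardJ : #|{: 'I_3 * ('I_N * 'I_k)}| = 3 * (N * k) by rewrite !card_prod !card_ord.
rewrite prednK // cardJ.
apply: rank_le_matmul_copies; rewrite ?card_ffun ?card_ord //.
by rewrite card_sig (card_ord 3) leq_exp2r // subset_leq_card //; apply/subsetP => a; rewrite inE.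
Qed.

Lemma simplifiable_SUSP_algorithm (F : fieldType) (l : nat) : 0 < #|P| -> 0 < l ->
  exists w g, [/\ #|P| ^ N <= w * N.+1 ^ #|P|, w <= q.+1 ^ (N * k),
    g * w ^ 3 <= 16 * q.+1 ^ (3 * (N * k)), 0 < g &
    let b := (q ^ (N * k)) ^ l in let r := g ^ l * w ^ 3 in
    1 < b /\ b * b <= r /\
    exists p : program F,
      multiplies_matrices_in_time p (fun n => (6 * up_log b n).+1 * (r * r ^ up_log b n))].
Proof.
move=> P0 l0; have [w [w_ge w_le rk]] := simplifiable_SUSP_rank F.
set r0 := 8 * _ in rk; pose g := (r0 %/ w ^ 3).+1.
have w0 : 0 < w.
  by move: w_ge; case: (w) => //; rewrite mul0n leqn0 expn_eq0 -leqn0 leqNgt P0.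
have f0 : 0 < w ^ 3 by rewrite expn_gt0 w0.
have r0g : r0 <= g * w ^ 3 by rewrite ltnW // ltn_ceil.
(* This bounds the rounding in [g]: [g * w ^ 3 <= r0 + w ^ 3 <= 2 * r0], which turns the factor 8
   into 16. *)
have fr0 : w ^ 3 <= r0.
  rewrite /r0 (mulnC 3) expnM; apply: leq_trans (leq_pmull _ _) => //.
  by rewrite leq_exp2r.
exists w, g; split => //.
  rewrite /g mulSn [16](_ : _ = 2 * 8) // -mulnA -/r0 mul2n -addnn.
  by apply: leq_add => //; apply: leq_trunc_div.
set b := (_ ^ _) ^ l; cbv zeta.
have b1 : 1 < b by rewrite /b -expnM -(expn0 q) ltn_exp2l // !muln_gt0 N0 k0.
have rk1 : rank_le (@matmul_copies F 'I_1 'I_b) (g ^ l * w ^ 3).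
  have := rank_le_matmul_pow l (rank_le_leq r0g rk).
  by apply: rank_le_matmul_copies; rewrite !card_ord.
split=> //; split; first exact: leq_rank_matmul rk1.
exact: rank_le_algorithm.
Qed.

End SimplifiableRank.

(** * Running time *)

From mathcomp Require Import all_classical all_reals all_analysis.
From mathcomp Require Import ring lra.
Import numFieldNormedType.Exports.

Local Open Scope classical_set_scope.
Local Open Scope ring_scope.

(** The power of [r] grows like [n] to the exponent [tau = log_b r]; the slack [delta = alpha - tau]
    absorbs the logarithmic number of levels. *)
Lemma running_time_bigO (R : realType) (b r : nat) (alpha : R) :
  (1 < b)%N -> (0 < r)%N -> ln (r%:R : R) < alpha * ln b%:R ->
  (fun n => ((6 * up_log b n).+1 * (r * r ^ up_log b n))%:R : R) =O_\oo (fun n => n%:R `^ alpha).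
Proof.
move=> b1 r0 alphaP.
have lnb : 0 < ln (b%:R : R) by apply: ln_gt0; rewrite ltr1n.
have rR : 0 < r%:R :> R by rewrite ltr0n.
pose tau := ln (r%:R : R) / ln b%:R.
have tau0 : 0 <= tau by apply: divr_ge0 (ltW lnb); apply: ln_ge0; rewrite ler1n.
pose delta := alpha - tau.
have delta0 : 0 < delta by rewrite subr_gt0 /tau ltr_pdivrMr.
(* With [up_log b n = e.+1] the time is [(6 * e + 7) * r ^ 2 * r ^ e]; the bounds on 1 and on [e] by
   multiples of [n] to the power [delta] give this constant. *)
pose C := (7 + 6 / (delta * ln b%:R)) * r%:R ^+ 2.
have C0 : 0 < C.
  by apply: mulr_gt0; rewrite ?exprn_gt0 // addr_gt0 // divr_gt0 // mulr_gt0.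
apply/eqO_exP; exists C => //; near=> n.
have n2 : (2 <= n)%N by near: n; exact: nbhs_infty_ge.
have n0 : 0 < n%:R :> R by rewrite ltr0n ltnW.
have [e eE] : exists e, up_log b n = e.+1.
  by exists (up_log b n).-1; rewrite prednK // up_log_gt0 b1.
have ben : b%:R ^+ e <= n%:R :> R.
  by rewrite -natrX ler_nat ltnW //; have := up_log_gtn b1 n2; rewrite eE.
have b0 : 0 < b%:R :> R by rewrite ltr0n ltnW.
have elnb : e%:R * ln b%:R <= ln n%:R :> R.
  by rewrite mulr_natl -lnXn // ler_ln // posrE ?exprn_gt0.
have re : (r%:R : R) ^+ e <= n%:R `^ tau.
  rewrite -ler_ln ?posrE ?exprn_gt0 ?powR_gt0 // ln_powR lnXn // -[_ *+ e]mulr_natl.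
  have -> : ln (r%:R : R) = tau * ln b%:R by rewrite /tau divfK // gt_eqF.
  by rewrite mulrCA ler_wpM2l.
have n1 : 1 <= n%:R :> R by rewrite ler1n ltnW.
have nd1 : 1 <= n%:R `^ delta by apply: le_trans (ler_powR n1 (ltW delta0)); rewrite powRr0.
have ed : e%:R <= n%:R `^ delta / (delta * ln b%:R).
  rewrite ler_pdivlMr ?mulr_gt0 // mulrCA.
  apply: le_trans (_ : delta * ln n%:R <= _); first by rewrite ler_wpM2l // ltW.
  by rewrite -ln_powR ltW // ln_sublinear // powR_gt0.
rewrite eE !ger0_norm ?powR_ge0 ?ler0n //.
have -> : alpha = delta + tau by rewrite /delta subrK.
rewrite powRD; last by apply/implyP => _; rewrite gt_eqF.
rewrite -addn1 !natrM natrD natrM natrX exprS -addn1 natrD.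
apply: le_trans (_ : (7 * n%:R `^ delta + 6 * (n%:R `^ delta / (delta * ln b%:R)))
  * (r%:R * (r%:R * n%:R `^ tau)) <= _).
  apply: ler_pM.
  - by rewrite addr_ge0 // mulr_ge0.
  - by rewrite !mulr_ge0 // ?exprn_ge0 // ltW.
  - by move: ed nd1; set x := _ / _; lra.
  - by rewrite !ler_pM2l.
by rewrite /C le_eqVlt; apply/orP; left; apply/eqP; ring.
Unshelve. all: by end_near.
Qed.

(** This provides an [N] for which the pigeonhole loss [N.+1 ^ s] and the constant 16 are
    negligible. *)
Lemma log_le_linear (R : realType) (a c eta : R) :
  0 <= a -> 0 <= c -> 0 < eta ->
  exists2 N : nat, (0 < N)%N & a + c * ln N.+1%:R <= eta * N%:R.
Proof.
move=> a0 c0 eta0; have [M MP] : exists M : nat, (a + 2 * c) / eta <= M%:R.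
  by exists (Num.truncn ((a + 2 * c) / eta)).+1; rewrite ltW // truncnS_gt.
(* N + 1 = (M + 2)^2, hence ln (N + 1) <= 2 (M + 1), whereas N = (M + 1) (M + 3). *)
exists (M.+2 ^ 2).-1 => //.
have -> : ((M.+2 ^ 2).-1.+1 = M.+2 ^ 2)%N by rewrite prednK.
have NE : (((M.+2 ^ 2).-1)%:R = M.+1%:R * M.+3%:R :> R).
  by rewrite -natrM; congr (_%:R); lia.
rewrite NE natrX lnXn ?ltr0n //.
have lnM : ln M.+2%:R <= M.+1%:R :> R.
  by rewrite -[M.+2]add1n natrD; apply: le_ln1Dx; rewrite (lt_le_trans (ltrN10 _)).
have M1 : 1 <= M.+1%:R :> R by rewrite ler1n.
move: MP; rewrite ler_pdivrMr // => MP.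
apply: le_trans (_ : (a + 2 * c) * M.+1%:R <= _).
  rewrite mulrDl; apply: lerD; first by rewrite ler_peMr.
  by rewrite -[_ *+ 2]mulr_natl mulrA [c * _]mulrC ler_wpM2l // mulr_ge0.
rewrite [X in eta * X]mulrC mulrA ler_wpM2r // (le_trans MP) // mulrC ler_wpM2l ?(ltW eta0) //.
by rewrite ler_nat -addn3 leq_addr.
Qed.

(** In logarithms the three bounds are linear. The last summand, from [w ^ 3], carries no factor [l]
    and so becomes negligible for large [l]. *)
Lemma log_rate_le (R : realType) (k s m N l w g : nat) :
  (0 < s)%N -> (2 < m)%N -> (0 < k)%N -> (0 < N)%N -> (0 < l)%N -> (0 < g)%N ->
  (s ^ N <= w * N.+1 ^ s)%N -> (w <= m ^ (N * k))%N -> (g * w ^ 3 <= 16 * m ^ (3 * (N * k)))%N ->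
  ln (g ^ l * w ^ 3)%:R <= l%:R * (ln 16 + 3 * s%:R * ln N.+1%:R
    + 3 * N%:R * (k%:R * ln m%:R - ln s%:R)) + 3 * (N * k)%:R * ln m%:R :> R.
Proof.
move=> s0 m2 k0 N0 l0 g0 w_ge w_le gw_le.
have m0 : (0 < m)%N by apply: leq_trans m2.
have w0 : (0 < w)%N.
  by move: w_ge; case: (w) => //; rewrite mul0n leqn0 expn_eq0 -leqn0 leqNgt s0.
have lnn (x : nat) : (0 < x)%N -> 0 < x%:R :> R by rewrite ltr0n.
have lnX (x e : nat) : (0 < x)%N -> ln ((x ^ e)%:R) = e%:R * ln x%:R :> R.
  by move=> x0; rewrite natrX lnXn ?lnn // mulr_natl.
have lnMn (x y : nat) : (0 < x)%N -> (0 < y)%N -> ln ((x * y)%:R) = ln x%:R + ln y%:R :> R.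
  by move=> x0 y0; rewrite natrM lnM ?posrE ?lnn.
have mono (x y : nat) : (0 < x)%N -> (x <= y)%N -> ln x%:R <= ln y%:R :> R.
  by move=> x0 xy; rewrite ler_ln ?posrE ?lnn ?ler_nat // (leq_trans x0).
have {}w_ge : N%:R * ln s%:R <= ln w%:R + s%:R * ln N.+1%:R :> R.
  by rewrite -!lnX // -lnMn ?expn_gt0 //; apply: mono; rewrite ?expn_gt0 ?s0.
have {}w_le : ln w%:R <= (N * k)%:R * ln m%:R :> R.
  by rewrite -lnX //; apply: mono.
have {}gw_le : ln g%:R + 3 * ln w%:R <= ln 16 + 3 * (N * k)%:R * ln m%:R :> R.
  have -> : 3 * (N * k)%:R = (3 * (N * k))%N%:R :> R by rewrite [RHS]natrM.
  by rewrite -(lnX w 3) // -lnX // -!lnMn ?expn_gt0 ?w0 ?m0 //; apply: mono;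
    rewrite ?muln_gt0 ?g0 ?expn_gt0 ?w0.
rewrite lnMn ?expn_gt0 ?g0 ?w0 // !lnX //.
apply: lerD; last by move: w_le; lra.
rewrite ler_wpM2l ?ler0n //; move: w_ge w_le gw_le; rewrite natrM.
set x := ln w%:R; set y := ln g%:R; set z := ln m%:R; set u := ln s%:R; set v := ln N.+1%:R.
nra.
Qed.

Theorem theorem2 (R : realType) (F : fieldType) (eps : R) (s k : nat) :
  0 < eps -> (1 <= s)%N -> (1 <= k)%N ->
  (exists P : puzzle k, #|P| = s /\ simplifiable_SUSP P) ->
  exists omega : R,
    omega <= inf [set 3 * ((k%:R * ln m%:R - ln s%:R) / (k%:R * ln (m%:R - 1)))
                 | m in [set m : nat | (3 <= m)%N]] /\
    exists (algorithm : program F) (T : nat -> nat),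
      multiplies_matrices_in_time algorithm T /\
      (fun n => (T n)%:R : R) =O_\oo (fun n => n%:R `^ (omega + eps)).
Proof.
move=> eps0 s0 k0 [P [Ps susp]].
set S := [set _ | _ in _]; exists (inf S); split=> //.
have sk : (s <= 3 ^ k)%N.
  by rewrite -Ps; apply: leq_trans (max_card _) _; rewrite card_ffun !card_ord.
have kR : 0 < k%:R :> R by rewrite ltr0n.
have lnq m : (3 <= m)%N -> 0 < ln (m%:R - 1) :> R.
  by move=> m3; rewrite ln_gt0 // ltrBrDr -[1 + 1]/(2%:R) ltr_nat.
have S_inf : has_inf S.
  split; first by exists (3 * ((k%:R * ln 3 - ln s%:R) / (k%:R * ln (3 - 1)))); exists 3%N.
  (* 0 is a lower bound because [s <= 3 ^ k <= m ^ k]. *)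
  exists 0 => _ [m /= m3 <-]; rewrite mulr_ge0 // divr_ge0 //; last first.
    by rewrite mulr_ge0 // ltW // lnq.
  rewrite subr_ge0 mulr_natl -lnXn ?ltr0n ?(leq_trans _ m3) // ler_ln ?posrE ?ltr0n //; last first.
    by rewrite -natrX ltr0n expn_gt0 (leq_trans _ m3).
  by rewrite -natrX ler_nat (leq_trans sk) // leq_exp2r.
(* A quarter of [eps] is spent on each of the choices of [m], [N] and [l]; the last quarter gives
   the strict inequality. *)
have eps4 : 0 < eps / 4 by rewrite divr_gt0.
have [_ [m /= m3 <-]] := inf_adherent eps4 S_inf.
set v := 3 * _ => v_lt.
case: m m3 @v v_lt => [//|q] q2 v v_lt.
have qE : q.+1%:R - 1 = q%:R :> R by rewrite -natr1 addrK.
have lnq0 : 0 < ln q%:R :> R by rewrite -qE lnq.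
have lnm0 : 0 <= ln q.+1%:R :> R by rewrite ln_ge0 // ler1n.
have ln16 : 0 <= ln 16 :> R by rewrite ln_ge0 // ler1n.
have [N N0 NP] := @log_le_linear R (ln 16) (3 * s%:R) (eps / 4 * (k%:R * ln q%:R)) ln16
  (mulr_ge0 (ler0n _ _) (ler0n _ _)) (mulr_gt0 eps4 (mulr_gt0 kR lnq0)).
have [l l0 lP] : exists2 l : nat, (0 < l)%N & 3 * ln q.+1%:R <= eps / 4 * ln q%:R * l%:R.
  exists (Num.truncn (3 * ln q.+1%:R / (eps / 4 * ln q%:R))).+1 => //.
  by rewrite [leRHS]mulrC -ler_pdivrMr ?mulr_gt0 // ltW // truncnS_gt.
have P0 : (0 < #|P|)%N by rewrite Ps.
have [w [g [w_ge w_le gw_le g0 [b1 [br [p pP]]]]]] :=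
  @simplifiable_SUSP_algorithm k P N q susp N0 k0 q2 F l P0 l0.
exists p; eexists; split; first exact: pP.
rewrite Ps in w_ge.
have r0 : (0 < g ^ l * w ^ 3)%N by apply: leq_trans br; rewrite muln_gt0 (ltnW b1).
apply: (running_time_bigO b1 r0).
have NR : 0 < N%:R :> R by rewrite ltr0n.
have lR : 0 < l%:R :> R by rewrite ltr0n.
apply: le_lt_trans (@log_rate_le R k s q.+1 N l w g s0 q2 k0 N0 l0 g0 w_ge w_le gw_le) _.
have -> : ln ((q ^ (N * k)) ^ l)%:R = l%:R * (N%:R * (k%:R * ln q%:R)) :> R.
  have q0 : (0 < q)%N := ltnW q2.
  rewrite -expnM natrX lnXn ?ltr0n // -[_ *+ _]mulr_natl !natrM.
  by ring.
have vE : 3 * (k%:R * ln q.+1%:R - ln s%:R) = v * (k%:R * ln q%:R).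
  by rewrite /v qE -mulrA divfK // mulf_neq0 // gt_eqF.
(* [Q] is the logarithm of the order [b] of the base algorithm. *)
pose Q : R := l%:R * (N%:R * (k%:R * ln q%:R)); rewrite -/Q.
have Q0 : 0 < Q by rewrite !mulr_gt0.
have N_term : l%:R * (ln 16 + 3 * s%:R * ln N.+1%:R) <= eps / 4 * Q.
  have -> : eps / 4 * Q = l%:R * (eps / 4 * (k%:R * ln q%:R) * N%:R) by rewrite /Q; ring.
  by rewrite ler_pM2l.
have l_term : 3 * (N * k)%:R * ln q.+1%:R <= eps / 4 * Q.
  have -> : eps / 4 * Q = (N * k)%:R * (eps / 4 * ln q%:R * l%:R) by rewrite /Q natrM; ring.
  by rewrite mulrAC [leLHS]mulrC ler_wpM2l.
have v_term : l%:R * (3 * N%:R * (k%:R * ln q.+1%:R - ln s%:R)) = v * Q.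
  have -> : v * Q = l%:R * N%:R * (v * (k%:R * ln q%:R)) by rewrite /Q; ring.
  by rewrite -vE; ring.
rewrite mulrDr v_term.
apply: le_lt_trans (lerD (lerD N_term (lexx _)) l_term) _.
rewrite -!mulrDl ltr_pM2r //.
by move: v_lt eps0; clear; move: (inf S) v => i v; lra.
Qed.
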